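(* Let $p(x)$ be a monic real-rooted polynomial of degree $n$. If $\widetilde{p'}(x)$ is the rescaling of $p'(x)$ satisfying $\mathrm{Var}(\widetilde{p'})=\mathrm{Var}(p)$, then the finite free entropy obeys $$\chi_n(p)+C_n\le\chi_{n-1}\big(\widetilde{p'}\big),$$ where $C_n:=\chi_{n-1}(\check H_{n-1})-\chi_n(\check H_n)$, and $\check H_n(x)$ and $\check H_{n-1}(x)$ are Hermite polynomials (of degrees $n$ and $n-1$) normalized so that $\mathrm{Var}(\check H_n)=\mathrm{Var}(\check H_{n-1})=1$. Moreover, $C_n>0$, so also $$\chi_n(p)<\chi_{n-1}\big(\widetilde{p'}\big).$$
   Context: For a real-rooted polynomial $p$ of degree $n$ with roots $\alpha_1,\dots,\alpha_n$ (with multiplicity), $m_k(p)=\frac1n\sum_{i=1}^n\alpha_i^k$ and $\mathrm{Var}(p)=m_2(p)-m_1(p)^2$. The finite free entropy of $p$ is $$\chi_n(p)=\frac{2}{n(n-1)}\sum_{i<j}\log|\alpha_i-\alpha_j|,$$ which depends only on the roots of $p$. For $c\ne0$ and a polynomial $q$ of degree $d$, $c_*q$ denotes the polynomial $(c_*q)(x)=c^{d}q(x/c)$, whose roots are $c$ times those of $q$; a rescaling of $p'$ is a polynomial of the form $c_*p'$. $H_n$ denotes the $n$-th monic probabilist's Hermite polynomial, $H_n(x)=e^{-\frac12\partial_x^2}x^n$, which has $\mathrm{Var}(H_n)=n-1$, and $\check H_n:=(n-1)^{-1/2}\,_*H_n$ is its rescaling with variance $1$.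
   Formalization: Taken with n ≥ 3 (the entropy of degree n−1 is otherwise undefined) and log 0 = −∞; the final strict inequality is claimed only when the entropy of the rescaled p' is not −∞, since both sides are −∞ if p has a root of multiplicity at least 3. *)

(* Defs.v *)
From HB Require Import structures.
From mathcomp Require Import all_boot all_order all_algebra.
From mathcomp Require Import classical_sets reals ereal exp.

Set Implicit Arguments.
Unset Strict Implicit.
Unset Printing Implicit Defensive.

Import Order.TTheory GRing.Theory Num.Theory.

Local Open Scope classical_set_scope.
Local Open Scope ring_scope.

Section FiniteFreeEntropy.
Variable R : realType.
Implicit Types (p q : {poly R}) (s : seq R) (c : R) (n k : nat).

Definition splits_as p s : Prop :=
  p = lead_coef p *: \prod_(a <- s) ('X - a%:P).

Definition real_rooted p : Prop := exists s, splits_as p s.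

(* The roots with multiplicity, in an arbitrary order (the sequence is unique
   up to permutation when p != 0); junk value [::] if p is not real-rooted. *)
Definition root_seq p : seq R := xget [::] [set s | splits_as p s].

Definition poly_moment k p : R :=
  (size (root_seq p))%:R^-1 * \sum_(a <- root_seq p) a ^+ k.

Definition poly_variance p : R := poly_moment 2 p - poly_moment 1 p ^+ 2.

(* Meaningful for p of degree n >= 2. The logarithm is extended by
   lne 0 = -oo, so that chi n p = -oo exactly when p has a repeated root. *)
Definition chi n p : \bar R :=
  ((2 / (n%:R * (n%:R - 1)))%:E *
   \sum_(i < n) \sum_(j < n | (i < j)%N)
      lne `|(root_seq p)`_i - (root_seq p)`_j|%:E)%E.

(* c_* q (x) = c ^ d * q (x / c), with d the degree of q. *)
Definition dilate c q : {poly R} :=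
  c ^+ (size q).-1 *: (q \Po (c^-1 *: 'X)).

(* exp (- D^2 / 2) x^n; the terms with 2 k > n vanish. *)
Definition hermite n : {poly R} :=
  \sum_(k < n.+1) ((- 2^-1) ^+ k / k`!%:R) *: ('X^n)^`((2 * k)%N).

Definition hermite_normalized n : {poly R} :=
  dilate (Num.sqrt (n%:R - 1))^-1 (hermite n).

Definition entropy_gap n : \bar R :=
  (chi n.-1 (hermite_normalized n.-1) - chi n (hermite_normalized n))%E.

End FiniteFreeEntropy.

Arguments hermite : clear implicits.
Arguments hermite_normalized : clear implicits.
Arguments entropy_gap : clear implicits.

(* Main.v *)
(* Everything is translation and scale invariant, so the claim is that
   F = chi_n(p) - chi_(n-1)(p') is maximal at the Hermite polynomial.

   Let J_i = sum_(j != i) 1 / (a_i - a_j) be the score of the roots a of p, and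
   b the roots of p'.  The points b are the eigenvalues of the compression of
   diag(a) to the orthogonal complement of (1, ..., 1); moving a in a direction
   v moves b_j at speed B_jj, where B is the compression of diag(v) written in
   the eigenbasis.  For v = J one finds B_jj = J(b)_j, so that
   |J(b)|^2 <= tr(B^2) = (1 - 2 / n) |J(a)|^2.
   This says exactly that F does not decrease, to first order, when a moves in
   the direction J(a), and chi_n itself strictly increases at fixed variance
   unless J(a) is proportional to a, which is the Hermite equation.  Hence on
   the compact set of standardized a with discriminant bounded from below, the
   maximum of K F + chi_n can only be the Hermite polynomial; let K tend to
   infinity.  With F replaced by 0 the same argument shows that the Hermite
   roots maximize chi_n at given variance; applied to the roots of H_n with one
   root deleted, and averaged over the deleted root, this gives C_n > 0. *)

Require Import Defs.
From mathcomp Require Import all_boot all_order all_algebra.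
From mathcomp Require Import classical_sets reals ereal exp.
From mathcomp Require Import boolp topology normedtype derive.
From mathcomp Require Import polyrcf ring lra zify.
Import Order.TTheory GRing.Theory Num.Theory.
Import numFieldNormedType.Exports.
Local Open Scope ring_scope.

Set Implicit Arguments.
Unset Strict Implicit.
Unset Printing Implicit Defensive.

(* The product runs over ordered pairs: this is the square of the discriminant,
   i.e. the fourth power of the Vandermonde product. *)
Definition disc2 (A : comNzRingType) n (f : 'I_n -> A) : A :=
  \prod_i \prod_(j | j != i) (f i - f j) ^+ 2.

Definition rootpoly (A : comNzRingType) n (f : 'I_n -> A) : {poly A} :=
  \prod_i ('X - (f i)%:P).

Definition score (F : fieldType) n (f : 'I_n -> F) (i : 'I_n) : F :=
  \sum_(j | j != i) (f i - f j)^-1.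

(** * Scores and discriminants *)

Section Field.
Variable F : fieldType.

Lemma logderiv_prod (I : Type) (r : seq I) (P : pred I) (q : I -> {poly F}) x :
  (forall i, P i -> (q i).[x] != 0) ->
  (\prod_(i <- r | P i) q i)^`().[x] =
  (\prod_(i <- r | P i) (q i).[x]) *
  \sum_(i <- r | P i) (q i)^`().[x] / (q i).[x].
Proof.
move=> q_neq0; elim: r => [|i r IHr].
  by rewrite !big_nil derivC horner0 mulr0.
rewrite !big_cons; case: ifP => // Pi.
rewrite derivM hornerD !hornerM IHr horner_prod.
by have := q_neq0 _ Pi => qi; field.
Qed.

Lemma logderiv_XsubC (I : Type) (r : seq I) (P : pred I) (f : I -> F) x :
  (forall i, P i -> x != f i) ->
  (\prod_(i <- r | P i) ('X - (f i)%:P))^`().[x] =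
  (\prod_(i <- r | P i) (x - f i)) * \sum_(i <- r | P i) (x - f i)^-1.
Proof.
move=> xf; rewrite logderiv_prod => [|i Pi]; last first.
  by rewrite hornerXsubC subr_eq0 xf.
congr (_ * _); first by apply: eq_bigr => i _; rewrite hornerXsubC.
by apply: eq_bigr => i _; rewrite hornerXsubC derivXsubC hornerC mul1r.
Qed.

Section RootPoly.
Variables (n : nat) (f : 'I_n -> F).

Let cof i := \prod_(j | j != i) ('X - (f j)%:P).

Lemma rootpolyD1 i : rootpoly f = ('X - (f i)%:P) * cof i.
Proof. by rewrite /rootpoly (bigD1 i). Qed.

Lemma horner_rootpoly x : (rootpoly f).[x] = \prod_i (x - f i).
Proof. by rewrite horner_prod; apply: eq_bigr => i _; rewrite hornerXsubC. Qed.

Lemma rootpoly_root i : (rootpoly f).[f i] = 0.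
Proof. by rewrite (rootpolyD1 i) hornerM hornerXsubC subrr mul0r. Qed.

Lemma monic_rootpoly : rootpoly f \is monic.
Proof. by apply: monic_prod => i _; rewrite monicXsubC. Qed.

Lemma size_rootpoly : size (rootpoly f) = n.+1.
Proof. by rewrite size_prod_XsubC /index_enum -enumT size_enum_ord. Qed.

Lemma deriv_rootpoly_root i : (rootpoly f)^`().[f i] = \prod_(j | j != i) (f i - f j).
Proof.
rewrite (rootpolyD1 i) derivM derivXsubC mul1r hornerD hornerM hornerXsubC.
rewrite subrr mul0r addr0 horner_prod.
by apply: eq_bigr => j _; rewrite hornerXsubC.
Qed.

(** Write p = (X - a_i) q: then p'(a_i) = q(a_i), p''(a_i) = 2 q'(a_i), and q'/q at a_i is the
    score. This links scores to differential equations for p. *)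
Lemma deriv2_rootpoly_root i : injective f ->
  (rootpoly f)^`()^`().[f i] = 2 * score f i * (rootpoly f)^`().[f i].
Proof.
move=> f_inj; rewrite deriv_rootpoly_root (rootpolyD1 i).
rewrite derivM derivXsubC mul1r derivD derivM derivXsubC mul1r.
rewrite !hornerD hornerM hornerXsubC subrr mul0r addr0.
rewrite logderiv_XsubC => [|j ji]; last first.
  by apply: contra_neq ji => /f_inj.
by rewrite -/(score f i); ring.
Qed.

End RootPoly.

Lemma deriv_rootpoly n (f : 'I_n -> F) :
  (rootpoly f)^`() = \sum_i \prod_(j | j != i) ('X - (f j)%:P).
Proof.
elim: n f => [|n IHn] f.
  by rewrite /rootpoly !big_ord0 derivC.
rewrite /rootpoly big_ord_recl derivM derivXsubC mul1r.
rewrite -/(rootpoly (fun i => f (lift ord0 i))) IHn.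
rewrite [RHS]big_ord_recl; congr (_ + _).
  by rewrite /rootpoly [RHS]big_mkcond /= big_ord_recl mul1r.
rewrite mulr_sumr; apply: eq_bigr => i _.
rewrite [RHS]big_mkcond big_ord_recl /=; congr (_ * _).
by rewrite big_mkcond; apply: eq_bigr => j _.
Qed.

Lemma sum_offdiag_sym (V : nmodType) n (G : 'I_n -> 'I_n -> V) :
  \sum_i \sum_(j | j != i) G i j = \sum_i \sum_(j | j != i) G j i.
Proof.
rewrite (exchange_big_dep predT) //=; apply: eq_bigr => i _.
by apply: eq_bigl => j; rewrite eq_sym.
Qed.

(** Since 1 / (f i - f j) is antisymmetric, the double sum can be added to its transpose. *)
Lemma sum_mul_score n (f v : 'I_n -> F) :
  2 * \sum_i v i * score f i =
  \sum_i \sum_(j | j != i) (v i - v j) / (f i - f j).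
Proof.
have E : \sum_i v i * score f i = \sum_i \sum_(j | j != i) v i / (f i - f j).
  by apply: eq_bigr => i _; rewrite /score mulr_sumr.
rewrite mulr_natl mulr2n {2}E sum_offdiag_sym E -big_split; apply: eq_bigr => i _.
rewrite -big_split; apply: eq_bigr => j _ /=.
by rewrite -[f j - f i]opprB invrN mulrN -mulrBl.
Qed.

Lemma score_sum0 n (f : 'I_n -> F) : 2 * \sum_i score f i = 0.
Proof.
have := sum_mul_score f (fun=> 1); under eq_bigr do rewrite mul1r.
by move=> ->; rewrite big1 // => i _; rewrite big1 // => j _; rewrite subrr mul0r.
Qed.

Lemma score_sumM n (f : 'I_n -> F) : injective f ->
  2 * \sum_i f i * score f i = (n * n.-1)%:R.
Proof.
move=> f_inj; rewrite sum_mul_score.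
rewrite (eq_bigr (fun=> n.-1%:R)) => [|i _].
  by rewrite sumr_const card_ord -mulrnA mulnC.
rewrite (eq_bigr (fun=> 1)) => [|j ji]; last first.
  by rewrite divff // subr_eq0; apply: contra_neq ji => /f_inj.
by rewrite sumr_const cardC1 card_ord.
Qed.

Lemma disc2_neq0 n (f : 'I_n -> F) : (disc2 f != 0) <-> injective f.
Proof.
split=> [/prodf_neq0 f0 i j fij | f_inj].
  apply/eqP; apply: contraT => ij; have /prodf_neq0 := f0 j isT.
  by move=> /(_ i ij); rewrite fij subrr expr0n eqxx.
apply/prodf_neq0 => i _; apply/prodf_neq0 => j ji.
by rewrite expf_neq0 // subr_eq0; apply: contra_neq ji => /f_inj.
Qed.

Lemma disc2_horner n (f : 'I_n -> {poly F}) x :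
  (disc2 f).[x] = disc2 (fun i => (f i).[x]).
Proof.
rewrite horner_prod; apply: eq_bigr => i _; rewrite horner_prod.
by apply: eq_bigr => j _; rewrite !hornerE.
Qed.

(** Time is the formal variable, so that directional derivatives become derivatives of polynomials
    at 0. *)
Definition line n (f v : 'I_n -> F) (i : 'I_n) : {poly F} :=
  (f i)%:P + 'X * (v i)%:P.

(** The gradient of log [disc2] is 4 times the score: a pair contributes in both orders, each time
    squared. *)
Lemma logderiv_disc2_line n (f v : 'I_n -> F) : injective f ->
  (disc2 (line f v))^`().[0] = disc2 f * (4 * \sum_i v i * score f i).
Proof.
move=> f_inj.
have l0 i : (line f v i).[0] = f i by rewrite /line !hornerE.
have l1 i : (line f v i)^`().[0] = v i.
  by rewrite /line derivD derivM derivX !derivC !hornerE.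
have fN i j : j != i -> f i - f j != 0.
  by move=> ji; rewrite subr_eq0; apply: contra_neq ji => /f_inj.
have h0 i j : ((line f v i - line f v j) ^+ 2).[0] = (f i - f j) ^+ 2.
  by rewrite horner_exp hornerD hornerN !l0.
have fN2 i j : j != i -> ((line f v i - line f v j) ^+ 2).[0] != 0.
  by move=> ji; rewrite h0 expf_neq0 ?fN.
rewrite /disc2 logderiv_prod => [|i _]; last first.
  by rewrite horner_prod; apply/prodf_neq0 => j; apply: fN2.
rewrite -horner_prod -/(disc2 (line f v)) disc2_horner.
congr (_ * _); first by apply: eq_bigr => i _; apply: eq_bigr => j _; rewrite !l0.
have -> : 4 = 2 * 2 :> F by ring.
rewrite -mulrA sum_mul_score mulr_sumr; apply: eq_bigr => i _.
rewrite logderiv_prod => [|j]; last exact: fN2.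
have D0 : \prod_(j | j != i) ((line f v i - line f v j) ^+ 2).[0] != 0.
  by apply/prodf_neq0 => j; apply: fN2.
rewrite horner_prod mulrAC divff // mul1r mulr_sumr; apply: eq_bigr => j ji.
have lB : (line f v i - line f v j).[0] = f i - f j by rewrite hornerD hornerN !l0.
have l'B : (line f v i - line f v j)^`().[0] = v i - v j.
  by rewrite derivB hornerD hornerN !l1.
rewrite h0 deriv_exp hornerMn hornerM horner_exp lB l'B.
by have := fN _ _ ji => ?; rewrite expr1; field.
Qed.

End Field.

Definition diagf (A : comNzRingType) n (v : 'I_n -> A) : 'M[A]_n :=
  diag_mx (\row_i v i).

Definition centering (F : fieldType) n : 'M[F]_n := 1%:M - const_mx n%:R^-1.

(** * Critical points as eigenvalues of a compression *)

Section CriticalPoints.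
Variables (F : realFieldType) (m : nat).
Variables (a : 'I_m.+1 -> F) (b : 'I_m -> F).
Hypothesis a_inj : injective a.
Hypothesis ab : (rootpoly a)^`() = m.+1%:R *: rootpoly b.

Lemma crit_neq j i : b j != a i.
Proof.
have : (rootpoly a)^`().[a i] != 0.
  rewrite deriv_rootpoly_root; apply/prodf_neq0 => k ki.
  by rewrite subr_eq0; apply: contra_neq ki => /a_inj.
by apply: contra_neq => <-; rewrite ab hornerZ rootpoly_root mulr0.
Qed.

Let S j i := (b j - a i)^-1.
(** The squared norm of the j-th eigenvector; dividing by it replaces a normalization by square
    roots. *)
Let N j := \sum_i S j i ^+ 2.

Lemma crit_subr_neq0 j i : b j - a i != 0.
Proof. by rewrite subr_eq0 crit_neq. Qed.

Lemma horner_rootpoly_crit_neq0 j : (rootpoly a).[b j] != 0.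
Proof. by rewrite horner_rootpoly; apply/prodf_neq0 => i _; apply: crit_subr_neq0. Qed.

(** The logarithmic derivative of p vanishes at b_j. Geometrically, the j-th eigenvector is
    orthogonal to (1, ..., 1). *)
Lemma sum_inv_crit j : \sum_i (b j - a i)^-1 = 0.
Proof.
have : (rootpoly a)^`().[b j] = 0 by rewrite ab hornerZ rootpoly_root mulr0.
rewrite /rootpoly logderiv_XsubC => [/eqP|i _]; last exact: crit_neq.
rewrite mulf_eq0 -horner_rootpoly (negPf (horner_rootpoly_crit_neq0 j)) /=.
by move/eqP.
Qed.

(** At b_j the cofactor has value p(b_j) / (b_j - a_i) and, by [sum_inv_crit], logarithmic
    derivative -1 / (b_j - a_i). *)
Lemma horner_deriv_cofactor_crit j i :
  (\prod_(k | k != i) ('X - (a k)%:P))^`().[b j] = - (rootpoly a).[b j] * S j i ^+ 2.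
Proof.
rewrite logderiv_XsubC => [|k _]; last exact: crit_neq.
have := sum_inv_crit j; rewrite (bigD1 i) //= => /eqP; rewrite addrC addr_eq0 => /eqP ->.
rewrite horner_rootpoly [in RHS](bigD1 i) //= /S.
by have := crit_subr_neq0 j i => ?; field.
Qed.

Lemma deriv2_crit j : (rootpoly a)^`()^`().[b j] = - (rootpoly a).[b j] * N j.
Proof.
rewrite deriv_rootpoly raddf_sum horner_sum /N mulr_sumr.
by apply: eq_bigr => i _; apply: horner_deriv_cofactor_crit.
Qed.

Lemma crit_norm_gt0 j : 0 < N j.
Proof.
rewrite /N (bigD1 ord0) //= ltr_wpDr ?sumr_ge0 // => [i _|]; first exact: sqr_ge0.
by rewrite exprn_even_gt0 //= invr_eq0 crit_subr_neq0.
Qed.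

Lemma crit_norm_neq0 j : N j != 0.
Proof. by rewrite gt_eqF // crit_norm_gt0. Qed.

(** A repeated critical point would be a zero of p'', but p''(b_k) = - p(b_k) N_k is nonzero. *)
Lemma crit_inj : injective b.
Proof.
move=> j k bjk; apply/eqP; apply: contraT => jk.
have : (rootpoly a)^`()^`().[b k] != 0.
  by rewrite deriv2_crit mulf_neq0 ?oppr_eq0 ?horner_rootpoly_crit_neq0 ?crit_norm_neq0.
rewrite ab derivZ hornerZ deriv_rootpoly_root (bigD1 j) //= bjk subrr.
by rewrite mul0r mulr0 eqxx.
Qed.

Lemma size_deriv_leq (p : {poly F}) k : (size p <= k.+1)%N -> (size p^`() <= k)%N.
Proof.
move=> sp; have [->|p0] := eqVneq p 0; first by rewrite deriv0 size_poly0.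
by rewrite -ltnS; apply: leq_trans (lt_size_deriv p0) _.
Qed.

Lemma rootpoly_interpolation n (f : 'I_n -> F) (p : {poly F}) : injective f ->
  (size p <= n)%N -> (forall i, p.[f i] = 0) -> p = 0.
Proof.
move=> f_inj sp pf; apply/eqP; apply: contraT => p0.
have := max_poly_roots p0 (rs := [seq f i | i <- enum 'I_n]).
rewrite size_map size_enum_ord map_inj_uniq ?enum_uniq //.
rewrite ltnNge sp => H; suff : false by []; apply: H => //.
by apply/allP => _ /mapP[i _ ->]; apply/eqP.
Qed.

(** Lagrange interpolation of p'' at the roots of p, where p''(a_i) = 2 J_i p'(a_i). *)
Lemma deriv2_rootpolyE :
  (rootpoly a)^`()^`() =
  \sum_i (2 * score a i) *: \prod_(k | k != i) ('X - (a k)%:P).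
Proof.
apply/eqP; rewrite -subr_eq0; apply/eqP; apply: (rootpoly_interpolation a_inj).
  apply: leq_trans (size_polyD _ _) _; rewrite geq_max size_polyN.
  apply/andP; split.
    apply: size_deriv_leq; apply: leq_trans (size_deriv_leq _) (leqnSn _).
    by rewrite size_rootpoly.
  apply: leq_trans (size_sum _ _ _) _; apply/bigmax_leqP => i _.
  apply: leq_trans (size_scale_leq _ _) _.
  by rewrite -big_filter size_prod_XsubC -sum1_size big_filter sum1_card cardC1 card_ord.
move=> i; rewrite hornerD hornerN deriv2_rootpoly_root // horner_sum.
have off k : k != i -> ((2 * score a k) *:
    \prod_(l | l != k) ('X - (a l)%:P)).[a i] = 0.
  move=> ki; rewrite hornerZ horner_prod (bigD1 i) 1?eq_sym //=.
  by rewrite hornerXsubC subrr mul0r mulr0.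
rewrite (bigD1 i) //= [X in _ - (_ + X)]big1 // addr0.
rewrite hornerZ deriv_rootpoly_root horner_prod.
apply/eqP; rewrite subr_eq0; apply/eqP; congr (_ * _).
by apply: eq_bigr => j _; rewrite hornerXsubC.
Qed.

(** Two evaluations of p'''(b_j) are compared: one through the scores of the roots b of p', one by
    differentiating the interpolation of p''. The score at b_j is thus a mean of the scores of a,
    with weights summing to 1. *)
Lemma score_crit j : score b j = \sum_i score a i * (S j i ^+ 2 / N j).
Proof.
have p2 := deriv2_crit j.
have p3 : (rootpoly a)^`()^`()^`().[b j] =
    - (rootpoly a).[b j] * (2 * \sum_i score a i * S j i ^+ 2).
  rewrite deriv2_rootpolyE raddf_sum horner_sum !mulr_sumr.
  by apply: eq_bigr => i _; rewrite /= derivZ hornerZ horner_deriv_cofactor_crit; ring.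
move: p2 p3; rewrite ab !derivZ !hornerZ deriv2_rootpoly_root; last exact: crit_inj.
move=> p2 p3; have pN := horner_rootpoly_crit_neq0 j; have NN := crit_norm_neq0 j.
under eq_bigr do rewrite mulrA; rewrite -mulr_suml.
apply: (mulIf NN); rewrite divfK //; apply: (mulfI pN); apply/eqP.
rewrite -(inj_eq (mulfI (_ : -2 != 0 :> F))) ?oppr_eq0 ?pnatr_eq0 //; apply/eqP.
transitivity (2 * score b j * (- (rootpoly a).[b j] * N j)); first by ring.
rewrite -p2; transitivity (m.+1%:R * (2 * score b j * (rootpoly b)^`().[b j])).
  by ring.
by rewrite p3; ring.
Qed.

(* The rows of [cauchy_mx] are eigenvectors, orthogonal but not normalized, of
   the compression of diag(a) to the complement of (1, ..., 1); [cauchy_pinv] is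
   the pseudo-inverse of [cauchy_mx]. *)
Definition cauchy_mx : 'M[F]_(m, m.+1) := \matrix_(j, i) S j i.
Definition cauchy_pinv : 'M[F]_(m.+1, m) := \matrix_(i, j) (S j i / N j).

Local Notation SS := cauchy_mx.
Local Notation TT := cauchy_pinv.

Lemma cauchy_mulK : SS *m TT = 1%:M.
Proof.
apply/matrixP => j k; rewrite !mxE.
under eq_bigr do rewrite !mxE mulrA.
rewrite -mulr_suml; have [->|jk] /= := eqVneq j k.
  by rewrite -[X in X / _]/(\sum_i S k i * S k i) divff // crit_norm_neq0.
have bjk : b k - b j != 0 by rewrite subr_eq0; apply: contra_neq jk => /crit_inj.
(* Partial fractions: distinct rows are orthogonal because both resulting sums vanish by
   [sum_inv_crit]. *)
rewrite (eq_bigr (fun i => (b k - b j)^-1 * (S j i - S k i))) => [|i _].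
  by rewrite -mulr_sumr sumrB !sum_inv_crit subrr mulr0 mul0r.
by have := crit_subr_neq0 j i; have := crit_subr_neq0 k i; rewrite /S => ? ?; field; apply/and3P.
Qed.

Lemma cauchy_pinv_colsum p : (const_mx 1 : 'M_(p, m.+1)) *m TT = 0.
Proof.
apply/matrixP => i j; rewrite !mxE.
under eq_bigr do rewrite !mxE mul1r.
by rewrite -mulr_suml sum_inv_crit mul0r.
Qed.

Lemma cauchy_mx_rowsum p : SS *m (const_mx m.+1%:R^-1 : 'M_(m.+1, p)) = 0.
Proof.
apply/matrixP => j i; rewrite !mxE.
under eq_bigr do rewrite !mxE.
by rewrite -mulr_suml sum_inv_crit mul0r.
Qed.

(** Bordering both matrices by a constant row or column makes them square, so that a right inverse
    is also a left inverse. *)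
Lemma mul_cauchy_centering : TT *m SS = centering F m.+1.
Proof.
pose L : 'M[F]_(1 + m) := col_mx (const_mx 1) SS.
pose Q : 'M[F]_(1 + m) := row_mx (const_mx m.+1%:R^-1) TT.
have : L *m Q = 1%:M.
  rewrite mul_col_row cauchy_mulK cauchy_pinv_colsum cauchy_mx_rowsum.
  rewrite [RHS](@scalar_mx_block _ 1 m 1); congr block_mx.
  apply/matrixP => i j; rewrite !mxE !ord1 /=.
  under eq_bigr do rewrite !mxE mul1r.
  by rewrite sumr_const card_ord -[LHS]mulr_natr mulVf // pnatr_eq0.
move/mulmx1C; rewrite mul_row_col addrC => /(canRL (addrK _)) ->; congr (_ - _).
apply/matrixP => i j; rewrite !mxE big_ord1 !mxE mulr1 //.
Qed.

Lemma cauchy_diag : SS *m diagf a *m TT = diagf b.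
Proof.
(* Entrywise a_i / (b_j - a_i) = b_j / (b_j - a_i) - 1; the all-ones matrix is killed by
   [cauchy_pinv]. *)
have -> : SS *m diagf a = diagf b *m SS - const_mx 1.
  rewrite mul_diag_mx mul_mx_diag; apply/matrixP => j i; rewrite !mxE /S.
  by have := crit_subr_neq0 j i => ?; field.
by rewrite mulmxBl -mulmxA cauchy_mulK mulmx1 cauchy_pinv_colsum subr0.
Qed.

Variable v : 'I_m.+1 -> F.

Definition compression : 'M[F]_m := SS *m diagf v *m TT.

Lemma compressionE j k : compression j k = (\sum_i v i * (S j i * S k i)) / N k.
Proof.
rewrite mxE mulr_suml; apply: eq_bigr => i _.
by rewrite mul_mx_diag !mxE; ring.
Qed.

(* The summand for k of the j-th diagonal entry of B^2 is B_jk B_kj, which is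
   nonnegative since B is symmetric up to rescaling. *)
Lemma compression_diag_le :
  \sum_j compression j j ^+ 2 <= \tr (compression *m compression).
Proof.
apply: ler_sum => j _; rewrite [leRHS]mxE (bigD1 j) //= -expr2 lerDl.
apply: sumr_ge0 => k _; rewrite !compressionE.
have -> : \sum_i v i * (S k i * S j i) = \sum_i v i * (S j i * S k i).
  by apply: eq_bigr => i _; ring.
rewrite mulrACA -expr2 mulr_ge0 ?sqr_ge0 // -invfM invr_ge0 mulr_ge0 //;
exact/ltW/crit_norm_gt0.
Qed.

(** By cyclicity this is the trace of (V P)^2, with V = diag(v) and P the centering. It is applied
    to the score, for [fisher_crit_le], and to v = a, for the second moment of b. *)
Lemma tr_compression_sqr :
  \tr (compression *m compression) =
  (1 - 2 / m.+1%:R) * \sum_i v i ^+ 2 + (\sum_i v i) ^+ 2 / m.+1%:R ^+ 2.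
Proof.
have -> : compression *m compression = SS *m (diagf v *m centering F _ *m diagf v *m TT).
  by rewrite -mul_cauchy_centering /compression !mulmxA.
rewrite mxtrace_mulC -!mulmxA mul_cauchy_centering.
have n0 : m.+1%:R != 0 :> F by rewrite pnatr_eq0.
rewrite mulmxA; set P := centering _ _.
have PE i k : P i k = (i == k)%:R - m.+1%:R^-1 by rewrite !mxE.
pose n' := m.+1%:R^-1 : F.
transitivity (\sum_i \sum_k v i * v k * P i k * P k i).
  apply: eq_bigr => i _; rewrite mxE; apply: eq_bigr => k _.
  by rewrite /diagf !mul_diag_mx !mxE; ring.
transitivity (\sum_i ((1 - 2 * n') * v i ^+ 2 + n' ^+ 2 * v i * \sum_k v k)).
  apply: eq_bigr => i _; rewrite (bigD1 i) //= !PE eqxx -/n'.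
  rewrite [in RHS](bigD1 i) //= [in RHS]mulrDr mulr_sumr addrA; congr (_ + _).
    by rewrite mulr1n; ring.
  apply: eq_bigr => k ki; rewrite !PE eq_sym (negPf ki) -/n' mulr0n; ring.
rewrite big_split /= -mulr_sumr -mulr_suml -mulr_sumr /n' exprVn; ring.
Qed.
End CriticalPoints.

(** Stated for any commutative law because it serves both products and sums. *)
Lemma big_offdiag_sym (A : Type) (idx : A) (op : Monoid.com_law idx) n
    (G : 'I_n -> 'I_n -> A) : (forall i j, G i j = G j i) ->
  \big[op/idx]_i \big[op/idx]_(j | j != i) G i j =
  op (\big[op/idx]_(i < n) \big[op/idx]_(j < n | (i < j)%N) G i j)
     (\big[op/idx]_(i < n) \big[op/idx]_(j < n | (i < j)%N) G i j).
Proof.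
move=> Gsym; rewrite [X in _ = op _ X](exchange_big_dep predT) //= -big_split.
apply: eq_bigr => i _ /=; rewrite (bigID (fun j : 'I_n => (i < j)%N)) /=.
congr (op _ _).
  by apply: eq_bigl => j; rewrite -val_eqE; case: ltngtP.
by apply: eq_big => [j|j _]; [rewrite -val_eqE; case: ltngtP | exact: Gsym].
Qed.

(** * The discriminant of the critical points as a Hankel determinant *)

Section Hankel.
Variable A : comNzRingType.

Definition hankel m (s : nat -> A) : A := \det (\matrix_(i < m, j < m) s (i + j)%N).

Lemma hankel_power_sum m (b : 'I_m -> A) :
  hankel m (fun k => \sum_j b j ^+ k) =
  (\prod_(i < m) \prod_(j < m | (i < j)%N) (b j - b i)) ^+ 2.
Proof.
pose V := Vandermonde m (\row_j b j).
rewrite /hankel (_ : \matrix_(i, j) _ = V *m V^T); last first.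
  apply/matrixP => i j; rewrite !mxE; apply: eq_bigr => k _.
  by rewrite !mxE exprD.
rewrite det_mulmx det_tr det_Vandermonde -expr2; congr (_ ^+ 2).
by apply: eq_bigr => i _; apply: eq_bigr => j _; rewrite !mxE.
Qed.

Lemma disc2_hankel m (b : 'I_m -> A) :
  disc2 b = hankel m (fun k => \sum_j b j ^+ k) ^+ 2.
Proof.
rewrite hankel_power_sum /disc2 big_offdiag_sym; last first.
  by move=> i j; rewrite -sqrrN opprB.
rewrite /= -expr2; congr (_ ^+ 2); rewrite -prodrXl; apply: eq_bigr => i _; rewrite -prodrXl.
by apply: eq_bigr => j _; rewrite -sqrrN opprB.
Qed.

(* For M = diag(a) * centering this is [disc2] of the critical points: M has
   their power sums as traces, except that its size is one too large for k = 0.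
   It is polynomial in a, while the critical points are only implicit. *)
Definition crit_disc m (M : 'M[A]_m.+1) : A :=
  hankel m (fun k => \tr (M ^+ k) - (k == 0%N)%:R) ^+ 2.

Lemma mxtrace_exp_mulC m n (M : 'M[A]_(m, n)) (N : 'M[A]_(n, m)) k :
  \tr ((M *m N) ^+ k.+1) = \tr ((N *m M) ^+ k.+1).
Proof.
have E : (M *m N) ^+ k.+1 = M *m ((N *m M) ^+ k *m N).
  elim: k => [|k IHk]; first by rewrite expr1 expr0 mul1mx.
  by rewrite exprS IHk -[_ * _]/(_ *m _) !mulmxA exprS -[_ * _ ^+ k]/(_ *m _) !mulmxA.
by rewrite E mxtrace_mulC -mulmxA exprSr.
Qed.

Lemma crit_disc_mulC m (M : 'M[A]_(m, m.+1)) (N : 'M[A]_(m.+1, m)) :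
  crit_disc (N *m M) = hankel m (fun k => \tr ((M *m N) ^+ k)) ^+ 2.
Proof.
rewrite /crit_disc /hankel; congr (\det _ ^+ 2); apply/matrixP => i j; rewrite !mxE.
case: (i + j)%N => [|k]; last by rewrite subr0 mxtrace_exp_mulC.
by rewrite !expr0 !mxtrace1 mulrSr addrK.
Qed.

End Hankel.

Lemma map_hankel (A B : comNzRingType) (f : {rmorphism A -> B}) m s :
  f (hankel m s) = hankel m (f \o s).
Proof. by rewrite /hankel -det_map_mx; congr (\det _); apply/matrixP => i j; rewrite !mxE. Qed.

Lemma map_crit_disc (A B : comNzRingType) (f : {rmorphism A -> B}) m (M : 'M[A]_m.+1) :
  f (crit_disc M) = crit_disc (map_mx f M).
Proof.
rewrite /crit_disc rmorphXn map_hankel /hankel; congr (\det _ ^+ 2).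
apply/matrixP => i j; rewrite !mxE /= rmorphB rmorph_nat -trace_map_mx.
by rewrite rmorphXn.
Qed.

(** * First-order perturbation of eigenvalues *)

Section FirstOrder.
Variable F : comNzRingType.

(** Congruence modulo X^2, that is, equality to first order in time. *)
Definition agree1 (p q : {poly F}) : Prop := p`_0 = q`_0 /\ p`_1 = q`_1.

Lemma agree1_refl p : agree1 p p. Proof. by []. Qed.

Lemma agree1D p q r s : agree1 p q -> agree1 r s -> agree1 (p + r) (q + s).
Proof. by case=> p0 p1 [r0 r1]; rewrite /agree1 !coefD p0 p1 r0 r1. Qed.

Lemma agree1M p q r s : agree1 p q -> agree1 r s -> agree1 (p * r) (q * s).
Proof.
case=> p0 p1 [r0 r1].
by rewrite /agree1 !coefM !big_ord_recl !big_ord0 /= ?subn0 ?subnn p0 p1 r0 r1.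
Qed.

Lemma agree1_hankel m s t : (forall k, agree1 (s k) (t k)) -> agree1 (hankel m s) (hankel m t).
Proof.
move=> st; rewrite /hankel /determinant.
apply: (big_ind2 agree1) => [||perm _]; [exact: agree1_refl|exact: agree1D|].
apply: agree1M; first exact: agree1_refl.
apply: (big_ind2 agree1) => [||i _]; [exact: agree1_refl|exact: agree1M|].
by rewrite !mxE.
Qed.

(** An off-diagonal entry of a power is divisible by X and returns to the diagonal only through
    another off-diagonal entry, again divisible by X. So to first order only the diagonal of B
    matters. *)
Lemma agree1_trace_exp m (b : 'I_m -> F) (B : 'M[F]_m) k :
  agree1 (\tr ((map_mx polyC (diagf b) + 'X *: map_mx polyC B) ^+ k))
      (\sum_j ((b j)%:P + 'X * (B j j)%:P) ^+ k).
Proof.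
set M := _ + _.
have ME i j : M i j = (b j *+ (i == j))%:P + 'X * (B i j)%:P.
  by rewrite !mxE eq_sym; case: eqVneq => // ->.
have coef0 k' i j : ((M ^+ k') i j)`_0 = b j ^+ k' *+ (i == j).
  elim: k' i j => [|k' IHk] i j; first by rewrite expr0 mxE expr0; case: eqP => _; rewrite ?coefC.
  rewrite exprSr mxE coef_sum (bigD1 j) //= big1 => [|l lj]; last first.
    by rewrite ME coefM big_ord_recl big_ord0 coefD coefC coefXM (negPf lj) /= !addr0 mulr0.
  rewrite ME coefM big_ord_recl big_ord0 coefD coefC coefXM eqxx /= !addr0 IHk.
  by rewrite mulrnAl exprSr.
have coef1 k' j : ((M ^+ k') j j)`_1 = (((b j)%:P + 'X * (B j j)%:P) ^+ k')`_1.
  elim: k' => [|k' IHk]; first by rewrite !expr0 mxE eqxx.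
  rewrite exprSr mxE coef_sum (bigD1 j) //= big1 => [|l lj]; last first.
    rewrite ME (negPf lj) coefM !big_ord_recl big_ord0 /= coef0 eq_sym (negPf lj) mulr0n.
    by rewrite mul0r add0r [_`_(1 - bump 0 0)]coefD coefC coefXM /= !addr0 mulr0.
  rewrite addr0 exprSr ME eqxx mulr1n !coefM !big_ord_recl !big_ord0 /= IHk coef0 eqxx mulr1n.
  congr (_ * _ + _).
  suff -> : (((b j)%:P + 'X * (B j j)%:P) ^+ k')`_0 = b j ^+ k' by [].
  by rewrite -horner_coef0 horner_exp !hornerE.
rewrite /agree1 /mxtrace !coef_sum; split; apply: eq_bigr => j _; rewrite ?coef1 //.
by rewrite coef0 eqxx -horner_coef0 horner_exp !hornerE.
Qed.

End FirstOrder.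

Definition cdisc (F : fieldType) m (a : 'I_m.+1 -> F) : F :=
  crit_disc (diagf a *m centering F m.+1).

Lemma diagfX (A : comNzRingType) m (b : 'I_m -> A) k :
  diagf b ^+ k = diagf (fun j => b j ^+ k).
Proof.
elim: k => [|k IHk].
  by apply/matrixP => i j; rewrite expr0 !mxE; case: eqP => // ->.
rewrite exprS IHk -[_ * _]/(_ *m _) mul_diag_mx.
by apply/matrixP => i j; rewrite !mxE exprS mulrnAr.
Qed.

(** * Variation of the discriminant of the critical points *)

Section CDisc.
Variables (F : realFieldType) (m : nat).
Variables (a : 'I_m.+1 -> F) (b : 'I_m -> F).
Hypothesis a_inj : injective a.
Hypothesis ab : (rootpoly a)^`() = m.+1%:R *: rootpoly b.

Lemma cdiscE : cdisc a = disc2 b.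
Proof.
rewrite /cdisc -(mul_cauchy_centering a_inj ab) mulmxA crit_disc_mulC disc2_hankel.
rewrite /hankel; congr (\det _ ^+ 2); apply/matrixP => i j; rewrite !mxE.
rewrite mulmxA cauchy_diag // diagfX; apply: eq_bigr => k _.
by rewrite !mxE eqxx.
Qed.

Definition cdisc_line (v : 'I_m.+1 -> F) : {poly F} :=
  crit_disc (diagf (line a v) *m map_mx polyC (centering F m.+1)).

Lemma horner_cdisc_line v x :
  (cdisc_line v).[x] = cdisc (fun i => a i + x * v i).
Proof.
rewrite -[LHS]/(horner_eval x _) map_crit_disc; congr crit_disc.
rewrite map_mxM /= -map_mx_comp; congr (_ *m _).
  by apply/matrixP => i j; rewrite !mxE /horner_eval hornerMn /line !hornerE.
by apply/matrixP => i j; rewrite !mxE /= /horner_eval hornerC.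
Qed.

Lemma diagf_line v :
  diagf (line a v) = map_mx polyC (diagf a) + 'X *: map_mx polyC (diagf v).
Proof.
apply/matrixP => i j; rewrite !mxE /line.
by case: eqP => _; rewrite ?mulr0n ?mulr1n // polyC0 mulr0 addr0.
Qed.

(** The first-order speed of b_j is the j-th diagonal entry of the compression; the critical points
    themselves are never followed in time. *)
Lemma agree1_cdisc_line v :
  agree1 (cdisc_line v) (disc2 (line b (fun j => compression a b v j j))).
Proof.
rewrite /cdisc_line -(mul_cauchy_centering a_inj ab) map_mxM mulmxA crit_disc_mulC.
rewrite disc2_hankel !expr2.
have E : agree1 (hankel m (fun k => \tr ((map_mx polyC (cauchy_mx a b) *m
      (diagf (line a v) *m map_mx polyC (cauchy_pinv a b))) ^+ k)))
    (hankel m (fun k => \sum_j line b (fun j => compression a b v j j) j ^+ k)).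
  apply: agree1_hankel => k; rewrite diagf_line.
  rewrite mulmxA mulmxDr mulmxDl -scalemxAr -scalemxAl -!map_mxM cauchy_diag //.
  exact: agree1_trace_exp.
exact: agree1M.
Qed.

Lemma deriv_horner0 (p : {poly F}) : p^`().[0] = p`_1.
Proof. by rewrite horner_coef0 coef_deriv. Qed.

Lemma logderiv_cdisc_line v :
  (cdisc_line v)^`().[0] =
  cdisc a * (4 * \sum_j compression a b v j j * score b j).
Proof.
have [_] := agree1_cdisc_line v; rewrite -!deriv_horner0 => ->.
by rewrite logderiv_disc2_line ?cdiscE //; apply: crit_inj a_inj ab.
Qed.

Lemma compression_score j : compression a b (score a) j j = score b j.
Proof.
rewrite compressionE (score_crit a_inj ab) mulr_suml; apply: eq_bigr => i _.
by rewrite -expr2 -mulrA.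
Qed.

Lemma score_sum_eq0 n (f : 'I_n -> F) : \sum_i score f i = 0.
Proof.
by have := score_sum0 f => /eqP; rewrite mulf_eq0 pnatr_eq0 /= => /eqP.
Qed.

(** In [compression_diag_le] for the score of a, the diagonal entries are the scores of b, and the
    mean term of the trace formula vanishes. *)
Lemma fisher_crit_le :
  \sum_j score b j ^+ 2 <= (1 - 2 / m.+1%:R) * \sum_i score a i ^+ 2.
Proof.
have := compression_diag_le a_inj ab (score a).
rewrite (tr_compression_sqr a_inj ab) score_sum_eq0 expr0n mul0r addr0.
by under eq_bigr do rewrite compression_score.
Qed.

Lemma logderiv_cdisc_score :
  (cdisc_line (score a))^`().[0] = cdisc a * (4 * \sum_j score b j ^+ 2).
Proof.
rewrite logderiv_cdisc_line; congr (_ * (_ * _)).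
by apply: eq_bigr => j _; rewrite compression_score expr2.
Qed.

Lemma crit_sum : \sum_j b j = (1 - m.+1%:R^-1) * \sum_i a i.
Proof.
have <- : \tr (diagf b) = \sum_j b j by apply: eq_bigr => j _; rewrite !mxE eqxx.
rewrite -(cauchy_diag a_inj ab) -mulmxA mxtrace_mulC -mulmxA (mul_cauchy_centering a_inj ab).
rewrite mulr_sumr; apply: eq_bigr => i _.
by rewrite mul_diag_mx !mxE eqxx mulrC.
Qed.

Lemma crit_sum_sqr : \sum_j b j ^+ 2 =
  (1 - 2 / m.+1%:R) * \sum_i a i ^+ 2 + (\sum_i a i) ^+ 2 / m.+1%:R ^+ 2.
Proof.
rewrite -(tr_compression_sqr a_inj ab) /compression cauchy_diag //.
rewrite -[_ *m _]/(diagf b ^+ 2) diagfX.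
by apply: eq_bigr => j _; rewrite !mxE eqxx.
Qed.

End CDisc.

(** * Rolle's theorem and growth rates *)

Section RealClosed.
Variable R : rcfType.

Lemma rootpoly_nth (A : comNzRingType) n (s : seq A) : size s = n ->
  \prod_(x <- s) ('X - x%:P) = rootpoly (fun i : 'I_n => s`_i).
Proof. by move=> <-; rewrite (big_nth 0) big_mkord. Qed.

(** Rolle between consecutive sorted roots gives m distinct zeros of p', which has degree m and
    leading coefficient m + 1. *)
Lemma crit_exists m (a : 'I_m.+1 -> R) : injective a ->
  exists b : 'I_m -> R, (rootpoly a)^`() = m.+1%:R *: rootpoly b.
Proof.
move=> a_inj; pose s := sort <=%R [seq a i | i <- enum 'I_m.+1].
have ss : size s = m.+1 by rewrite size_sort size_map size_enum_ord.
have us : uniq s by rewrite sort_uniq map_inj_uniq ?enum_uniq.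
have slt : sorted <%R s by rewrite lt_sorted_uniq_le us; apply: sort_le_sorted.
have sle i j : (i <= j < m.+1)%N -> s`_i <= s`_j.
  move=> /andP[ij jm]; apply: (sorted_leq_nth le_trans lexx) => //; rewrite ?inE ?ss //.
    exact: sort_le_sorted.
  exact: leq_ltn_trans jm.
have rs i : (i < m.+1)%N -> (rootpoly a).[s`_i] = 0.
  move=> im; have : s`_i \in s by rewrite mem_nth ?ss.
  by rewrite mem_sort => /mapP[k _ ->]; apply: rootpoly_root.
have roll (i : 'I_m) : {c | c \in `]s`_i, s`_i.+1[ & (rootpoly a)^`().[c] = 0}.
  apply: poly_rolle; last by rewrite !rs ?ltnS // ltnW.
  by apply: (sorted_ltn_nth lt_trans) => //; rewrite ?inE ss ltnS // ltnW.
pose b (i : 'I_m) : R := s2val (roll i).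
have b_itv (i : 'I_m) : s`_i < b i < s`_i.+1 by have := s2valP (roll i); rewrite in_itv.
have b_root (i : 'I_m) : (rootpoly a)^`().[b i] = 0 by apply: (s2valP' (roll i)).
have b_lt (i j : 'I_m) : (i < j)%N -> b i < b j.
  move=> ij; have /andP[_ bi] := b_itv i; have /andP[bj _] := b_itv j.
  apply: lt_trans bi _; apply: le_lt_trans bj; apply: sle.
  by rewrite ij ltnS ltnW.
have b_inj : injective b.
  move=> i j bij; apply/val_inj; case: (ltngtP i j) => // /b_lt;
  by rewrite bij ltxx.
exists b.
have lc : (rootpoly a)^`()`_m = m.+1%:R.
  rewrite coef_deriv; have := monic_rootpoly a; rewrite monicE lead_coefE size_rootpoly.
  by move=> /eqP ->.
have sz : size (rootpoly a)^`() = m.+1.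
  apply/eqP; rewrite eqn_leq size_deriv_leq ?size_rootpoly //= ltnNge.
  apply/negP => /(nth_default 0) /eqP; rewrite lc pnatr_eq0 //.
rewrite (@all_roots_prod_XsubC _ (rootpoly a)^`() [seq b i | i <- enum 'I_m]).
- rewrite lead_coefE sz lc; congr (_ *: _).
  by rewrite big_map big_enum.
- by rewrite size_map size_enum_ord.
- by apply/allP => _ /mapP[i _ ->]; apply/eqP.
by rewrite uniq_rootsE map_inj_uniq ?enum_uniq.
Qed.

Lemma poly_pos_right (p : {poly R}) : p.[0] = 0 -> 0 < p^`().[0] ->
  exists2 e, 0 < e & forall x, 0 < x < e -> 0 < p.[x].
Proof.
move=> /eqP /factor_theorem[q ->]; rewrite subr0 => p'0.
have q0 : 0 < q.[0] by move: p'0; rewrite derivM derivX mulr1 hornerD hornerM hornerX mulr0 add0r.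
have [d d0 dq] := poly_cont 0 q q0.
exists d => // x /andP[x0 xd]; rewrite hornerM hornerX mulr_gt0 //.
have := dq x; rewrite subr0 gtr0_norm // => /(_ xd).
by rewrite ltr_norml => /andP[+ _]; lra.
Qed.

(** Cross-multiplying avoids quotients: the difference of the two sides vanishes at 0 with
    derivative p(0) q(0) (lp - lq). *)
Lemma logderiv_lt (p q : {poly R}) lp lq :
  0 < p.[0] -> 0 < q.[0] -> p^`().[0] = p.[0] * lp -> q^`().[0] = q.[0] * lq ->
  lq < lp ->
  exists2 e, 0 < e & forall x, 0 < x < e -> q.[x] * p.[0] < p.[x] * q.[0].
Proof.
move=> p0 q0 p'0 q'0 lpq.
have [||e e0 eP] := @poly_pos_right (p * (q.[0])%:P - q * (p.[0])%:P).
- by rewrite !hornerE mulrC subrr.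
- rewrite derivB !derivM !derivC !mulr0 !addr0 !hornerE p'0 q'0.
  rewrite (_ : _ - _ = p.[0] * q.[0] * (lp - lq)); last by ring.
  by rewrite !mulr_gt0 // subr_gt0.
exists e => // x /eP; rewrite !hornerE subr_gt0 //.
Qed.

Lemma logderivX (p : {poly R}) lp k : p^`().[0] = p.[0] * lp ->
  (p ^+ k)^`().[0] = (p ^+ k).[0] * (lp *+ k).
Proof.
move=> p'0; rewrite deriv_exp hornerMn hornerM p'0 !horner_exp.
case: k => [|k]; first by rewrite !mulr0n mulr0.
by rewrite /= -mulrnAr exprS; ring.
Qed.

Lemma logderivM (p q : {poly R}) lp lq : p^`().[0] = p.[0] * lp -> q^`().[0] = q.[0] * lq ->
  (p * q)^`().[0] = (p * q).[0] * (lp + lq).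
Proof. by move=> p0 q0; rewrite derivM !hornerE p0 q0; ring. Qed.

End RealClosed.

(** * The maximum of the ratio of discriminants *)

Section Continuity.
Local Open Scope classical_set_scope.
Variables (R : realType) (T : topologicalType).

Lemma continuous_sum (I : Type) (r : seq I) (P : pred I) (f : I -> T -> R) :
  (forall i, P i -> continuous (f i)) ->
  continuous (fun x => \sum_(i <- r | P i) f i x).
Proof. by move=> cf; apply: continuous_big => //; apply: add_continuous. Qed.

Lemma continuous_prod (I : Type) (r : seq I) (P : pred I) (f : I -> T -> R) :
  (forall i, P i -> continuous (f i)) ->
  continuous (fun x => \prod_(i <- r | P i) f i x).
Proof. by move=> cf; apply: continuous_big => //; apply: mul_continuous. Qed.

Lemma continuous_mul (f g : T -> R) :
  continuous f -> continuous g -> continuous (fun x => f x * g x).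
Proof. by move=> cf cg x; apply: continuousM; [apply: cf | apply: cg]. Qed.

Lemma continuous_sub (f g : T -> R) :
  continuous f -> continuous g -> continuous (fun x => f x - g x).
Proof. by move=> cf cg x; apply: continuousB; [apply: cf | apply: cg]. Qed.

Lemma continuous_exp (f : T -> R) k :
  continuous f -> continuous (fun x => f x ^+ k).
Proof.
move=> cf; elim: k => [|k IHk]; first exact: cst_continuous.
by under eq_fun do rewrite exprS; apply: continuous_mul.
Qed.

Lemma continuous_det m (M : T -> 'M[R]_m) :
  (forall i j, continuous (fun x => M x i j)) -> continuous (fun x => \det (M x)).
Proof.
move=> cM; apply: continuous_sum => s _; apply: continuous_mul.
  exact: cst_continuous.
by apply: continuous_prod => i _.
Qed.

Lemma continuous_mx_exp m (M : T -> 'M[R]_m) k :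
  (forall i j, continuous (fun x => M x i j)) ->
  forall i j, continuous (fun x => (M x ^+ k) i j).
Proof.
move=> cM; elim: k => [|k IHk] i j.
  exact: cst_continuous.
under eq_fun do rewrite exprS mxE.
by apply: continuous_sum => l _; apply: continuous_mul.
Qed.

Lemma continuous_disc2 n (f : T -> 'I_n -> R) :
  (forall i, continuous (f ^~ i)) -> continuous (fun x => disc2 (f x)).
Proof.
move=> cf; apply: continuous_prod => i _; apply: continuous_prod => j _.
by apply: continuous_exp; apply: continuous_sub.
Qed.

Lemma continuous_cdisc m (f : T -> 'I_m.+1 -> R) :
  (forall i, continuous (f ^~ i)) -> continuous (fun x => cdisc (f x)).
Proof.
move=> cf; apply: continuous_exp; apply: continuous_det => i j.
under eq_fun do rewrite mxE; apply: continuous_sub; last exact: cst_continuous.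
apply: continuous_sum => k _; apply: continuous_mx_exp => {i j k} i j.
under eq_fun do rewrite /diagf mul_diag_mx !mxE.
by apply: continuous_mul => //; apply: cst_continuous.
Qed.

End Continuity.

Section Maximum.
Local Open Scope classical_set_scope.
Variables (R : realType) (m : nat) (x y : nat).

Lemma disc2_ge0 n (f : 'I_n -> R) : 0 <= disc2 f.
Proof. by apply: prodr_ge0 => i _; apply: prodr_ge0 => j _; apply: sqr_ge0. Qed.

Lemma disc2_gt0 n (f : 'I_n -> R) : (0 < disc2 f) <-> injective f.
Proof. by rewrite lt_def disc2_ge0 andbT; apply: disc2_neq0. Qed.

Lemma ler_div_cross (p q r s : R) : 0 < r -> 0 < s -> p / r <= q / s -> p * s <= q * r.
Proof. by move=> r0 s0; rewrite ler_pdivrMr // mulrAC ler_pdivlMr. Qed.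

Lemma cdisc_gt0 (a : 'I_m.+1 -> R) : injective a -> 0 < cdisc a.
Proof.
move=> a_inj; have [b ab] := crit_exists a_inj.
by rewrite (cdiscE a_inj ab) disc2_gt0; apply: crit_inj a_inj ab.
Qed.

Let E : R := (m.+1 * m)%:R.

(** The value E = n (n - 1) is that of the roots of H_n; it makes the critical equation J_i = a_i /
    2. *)
Definition standardized (a : 'I_m.+1 -> R) : Prop :=
  [/\ injective a, \sum_i a i = 0 & \sum_i a i ^+ 2 = E].

(** The lower bound on [disc2] keeps the roots distinct on a compact set, so that [cdisc] is nonzero
    there and the quotient continuous. The exponents x and y encode a weighted difference of two
    logarithms. *)
Lemma disc_ratio_max (a0 : 'I_m.+1 -> R) : standardized a0 ->
  exists2 h, standardized h /\ disc2 a0 <= disc2 h &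
  forall a, standardized a -> disc2 a0 <= disc2 a ->
    disc2 a ^+ x * cdisc h ^+ y <= disc2 h ^+ x * cdisc a ^+ y.
Proof.
move=> [a0_inj a0_0 a0_E].
pose K : set 'rV[R]_m.+1 := [set a | [/\ \sum_i a 0 i = 0,
  \sum_i a 0 i ^+ 2 = E & disc2 a0 <= disc2 (a 0)]].
have cc i : continuous (fun a : 'rV[R]_m.+1 => a 0 i) by apply: coord_continuous.
have K_inj a : K a -> injective (a 0).
  by move=> [_ _ d]; apply/disc2_gt0; apply: lt_le_trans d; apply/disc2_gt0.
have K_closed : closed K.
  have -> : K = [set a | \sum_i a 0 i = 0] `&` ([set a | \sum_i a 0 i ^+ 2 = E]
      `&` [set a | disc2 a0 <= disc2 (a 0)]).
    by apply/seteqP; split=> a; [case | case=> ? []].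
  apply: closedI; last apply: closedI.
  - apply: (@preimage_closed _ _ (fun a : 'rV[R]_m.+1 => \sum_i a 0 i) [set t | t = 0]).
      by move=> t _; apply: continuous_sum.
    exact: closed_eq.
  - apply: (@preimage_closed _ _ (fun a : 'rV[R]_m.+1 => \sum_i a 0 i ^+ 2) [set t | t = E]).
      by move=> t _; apply: continuous_sum => i _; apply: continuous_exp.
    exact: closed_eq.
  apply: (@preimage_closed _ _ (fun a : 'rV[R]_m.+1 => disc2 (a 0)) [set t | disc2 a0 <= t]).
    by move=> t _; apply: continuous_disc2.
  exact: closed_ge.
have K_compact : compact K.
  (* The box suffices since a_i^2 <= E gives |a_i| <= E + 1. *)
  have box := @rV_compact _ m.+1 (fun=> `[- (E + 1), E + 1]%classic)
    (fun=> @segment_compact _ (- (E + 1)) (E + 1)).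
  apply: subclosed_compact K_closed box _.
  move=> a [_ aE _] i /=; rewrite in_itv /= -ler_norml.
  have ai : a 0 i ^+ 2 <= E.
    by rewrite -aE (bigD1 i) //= lerDl sumr_ge0 // => j _; apply: sqr_ge0.
  rewrite -real_normK ?num_real // in ai.
  have := normr_ge0 (a 0 i); nra.
pose g (a : 'rV[R]_m.+1) := disc2 (a 0) ^+ x / cdisc (a 0) ^+ y.
have gK : {within K, continuous g}.
  apply: continuous_in_subspaceT => a /set_mem Ka.
  have cX : continuous (fun a : 'rV[R]_m.+1 => disc2 (a 0) ^+ x).
    by apply: continuous_exp; apply: continuous_disc2.
  have cY : continuous (fun a : 'rV[R]_m.+1 => cdisc (a 0) ^+ y).
    by apply: continuous_exp; apply: continuous_cdisc.
  apply: (@cvgM _ _ _ _ _ _ _ _ (cX a)).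
  apply: cvgV; last exact: cY.
  by rewrite expf_neq0 // gt_eqF // cdisc_gt0 //; apply: K_inj.
have row0 (f : 'I_m.+1 -> R) : (\row_i f i : 'rV_m.+1) 0 = f :> (_ -> _).
  by apply/funext => i; rewrite mxE.
have K0 : K !=set0.
  by exists (\row_i a0 i); rewrite /K /= row0.
have [h /set_mem Kh hmax] := compact_EVT_max K0 K_compact gK.
have h_inj := K_inj _ Kh; case: (Kh) => h0 hE hd.
exists (h 0); first exact: (conj (And3 h_inj h0 hE) hd).
move=> a [a_inj a_0 a_E] ad.
have Ka : K (\row_i a i) by rewrite /K /= row0.
have := hmax _ (mem_set Ka); rewrite /g row0.
have Ya : 0 < cdisc a ^+ y by rewrite exprn_gt0 ?cdisc_gt0.
have Yh : 0 < cdisc (h 0) ^+ y by rewrite exprn_gt0 ?cdisc_gt0.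
exact: ler_div_cross.
Qed.

End Maximum.

(** * Ascent along the score *)

Section Ascent.
Variables (R : realType) (m : nat) (x y : nat).
Hypothesis m_gt0 : (0 < m)%N.
(** Equality would make [disc2 a ^+ x / cdisc a ^+ y] scale invariant; strictness leaves a positive
    extra weight on [disc2]. *)
Hypothesis xy : (y * m.-1 < x * m.+1)%N.

Lemma disc2_affine n (f : 'I_n -> R) (t u : R) :
  disc2 (fun i => t * f i + u) = (t ^+ 2) ^+ (n * n.-1) * disc2 f.
Proof.
transitivity (\prod_(i < n) \prod_(j | j != i) (t ^+ 2 * (f i - f j) ^+ 2)).
  apply: eq_bigr => i _; apply: eq_bigr => j _; ring.
rewrite (eq_bigr (fun i => (t ^+ 2) ^+ n.-1 * \prod_(j | j != i) (f i - f j) ^+ 2)).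
  by rewrite mulnC exprM big_split /= prodr_const card_ord.
by move=> i _; rewrite big_split /= prodr_const cardC1 card_ord.
Qed.

Lemma rootpoly_affine n (f : 'I_n -> R) (t u : R) : t != 0 ->
  rootpoly (fun i => t * f i + u) =
  t ^+ n *: (rootpoly f \Po (t^-1 *: ('X - u%:P))).
Proof.
move=> t0; rewrite /rootpoly rmorph_prod /= -[n in t ^+ n]card_ord -prodr_const.
rewrite -scaler_prod; apply: eq_bigr => i _.
rewrite comp_polyB comp_polyX comp_polyC scalerBr scalerA divff // scale1r.
by rewrite -mul_polyC -polyCM polyCD opprD addrA addrAC.
Qed.

Lemma crit_affine (a : 'I_m.+1 -> R) (b : 'I_m -> R) (t u : R) : t != 0 ->
  (rootpoly a)^`() = m.+1%:R *: rootpoly b ->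
  (rootpoly (fun i => t * a i + u))^`() =
  m.+1%:R *: rootpoly (fun j => t * b j + u).
Proof.
move=> t0 ab; rewrite !rootpoly_affine // derivZ deriv_comp ab comp_polyZ.
rewrite derivZ derivXsubC -!scalerAl -scalerAr mulr1 !scalerA; congr (_ *: _).
by rewrite exprSr; field.
Qed.

Lemma affine_inj n (a : 'I_n -> R) (t u : R) : t != 0 -> injective a ->
  injective (fun i => t * a i + u).
Proof. by move=> t0 a_inj i j /addIr /(mulfI t0) /a_inj. Qed.

Lemma cdisc_affine (a : 'I_m.+1 -> R) (t u : R) : t != 0 -> injective a ->
  cdisc (fun i => t * a i + u) = (t ^+ 2) ^+ (m * m.-1) * cdisc a.
Proof.
move=> t0 a_inj; have [b ab] := crit_exists a_inj.
rewrite (cdiscE a_inj ab) (cdiscE (affine_inj t0 a_inj) (crit_affine u t0 ab)).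
exact: disc2_affine.
Qed.

(** Here s is the squared scale factor, k and l are the degrees of the two discriminants in it, and
    d is the weighted difference of these degrees. *)
Lemma rescaled_ratio_lt (X0 X1 Y0 Y1 s q : R) k l d : 0 < s -> 0 < q ->
  (k * x = l * y + d)%N ->
  Y1 ^+ y * q ^+ d * X0 ^+ x < X1 ^+ x * (Y0 ^+ y * (s * q) ^+ d) ->
  X0 ^+ x * (s ^+ l * Y1) ^+ y < (s ^+ k * X1) ^+ x * Y0 ^+ y.
Proof.
move=> s_gt0 q_gt0 kld lt.
rewrite !exprMn -!exprM kld exprD -(ltr_pM2l (exprn_gt0 d q_gt0)).
rewrite -(ltr_pM2l (exprn_gt0 (l * y) s_gt0)) exprMn in lt.
rewrite [ltLHS](_ : _ = s ^+ (l * y) * (Y1 ^+ y * q ^+ d * X0 ^+ x)); last by ring.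
by apply: (lt_le_trans lt); rewrite le_eqVlt; apply/orP; left; apply/eqP; ring.
Qed.

Let n := m.+1.
Let E : R := (n * m)%:R.
Let d := (x * (n * m) - y * (m * m.-1))%N.

Let exponent_le : (y * (m * m.-1) <= x * (n * m))%N.
Proof. by rewrite mulnCA [leqRHS]mulnA [leqRHS]mulnC leq_mul2l ltnW ?orbT. Qed.

Let exponentE : (n * m * x = m * m.-1 * y + d)%N.
Proof. by rewrite (mulnC _ x) (mulnC _ y) subnKC // exponent_le. Qed.

(* Moving along the score and rescaling back. The exponent d makes
   [disc2 a ^+ x / (cdisc a ^+ y * (\sum_i a i ^+ 2) ^+ d)] scale invariant. *)
Lemma ascent (a : 'I_m.+1 -> R) : standardized a -> (exists i, score a i != a i / 2) ->
  exists2 a' : 'I_m.+1 -> R, standardized a' & disc2 a < disc2 a' /\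
    disc2 a ^+ x * cdisc a' ^+ y < disc2 a' ^+ x * cdisc a ^+ y.
Proof.
move=> [a_inj a_0 a_E] [i0 i0P]; have [b ab] := crit_exists a_inj.
have {}a_E : \sum_i a i ^+ 2 = E by [].
have E_gt0 : 0 < E by rewrite ltr0n muln_gt0 m_gt0.
pose v := score a.
pose J := \sum_i v i ^+ 2; pose Jb := \sum_j score b j ^+ 2.
have av : \sum_i a i * v i = E / 2.
  by have := score_sumM a_inj; rewrite -/E -/v => <-; field.
(* Since a has inner product E / 2 with the score, J exceeds E / 4 by the squared distance from the
   score to a / 2. *)
have J_gt : E / 4 < J.
  rewrite -subr_gt0 (_ : _ - _ = \sum_i (v i - a i / 2) ^+ 2).
    rewrite lt_def sumr_ge0 ?andbT => [|i _]; last exact: sqr_ge0.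
    apply/negP; rewrite psumr_eq0 => [/allP/(_ i0)|i _]; last exact: sqr_ge0.
    by rewrite mem_index_enum /= sqrf_eq0 subr_eq0 (negPf i0P) => /(_ isT).
  rewrite (eq_bigr (fun i => v i ^+ 2 - a i * v i + a i ^+ 2 / 4)) => [|i _]; last by field.
  by rewrite big_split sumrB /= -mulr_suml a_E av /J; field.
pose Q : {poly R} := \sum_i line a v i ^+ 2.
have Qe e : Q.[e] = \sum_i (a i + e * v i) ^+ 2.
  by rewrite horner_sum; apply: eq_bigr => i _; rewrite !hornerE.
have Q0 : Q.[0] = E by rewrite Qe -a_E; apply: eq_bigr => i _; rewrite mul0r addr0.
have Q'0 : Q^`().[0] = Q.[0] * 1.
  rewrite mulr1 Q0 raddf_sum horner_sum /=.
  transitivity (2 * \sum_i a i * v i); last by rewrite av; field.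
  rewrite mulr_sumr; apply: eq_bigr => i _.
  rewrite /line deriv_exp derivD derivM derivX !derivC !hornerE /=; ring.
pose X := disc2 (line a v).
have Xe e : X.[e] = disc2 (fun i => a i + e * v i).
  by rewrite disc2_horner; congr disc2; apply/funext => i; rewrite !hornerE.
have X0 : X.[0] = disc2 a.
  by rewrite Xe; congr disc2; apply/funext => i; rewrite mul0r addr0.
have X'0 : X^`().[0] = X.[0] * (4 * J).
  by rewrite X0 logderiv_disc2_line //; under eq_bigr do rewrite -expr2.
pose Y := cdisc_line a v.
have Ye e : Y.[e] = cdisc (fun i => a i + e * v i) by apply: horner_cdisc_line.
have Y0 : Y.[0] = cdisc a.
  by rewrite Ye; congr cdisc; apply/funext => i; rewrite mul0r addr0.
have Y'0 : Y^`().[0] = Y.[0] * (4 * Jb) by rewrite Y0 (logderiv_cdisc_score a_inj ab).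
have JbJ : Jb <= (1 - 2 / n%:R) * J by apply: fisher_crit_le.
have X_gt0 : 0 < X.[0] by rewrite X0 disc2_gt0.
have Y_gt0 : 0 < Y.[0] by rewrite Y0 cdisc_gt0.
have Q_gt0 : 0 < Q.[0] by rewrite Q0.
clearbody Q X Y.
(* The discriminant outgrows the power of the squared norm having the same degree, because 4 J > E =
   n m. *)
have [|||e1 e1_gt0 P1] := @logderiv_lt R X (Q ^+ (n * m)) (4 * J) (1 *+ (n * m)) X_gt0 _ X'0 _ _.
- by rewrite horner_exp exprn_gt0.
- exact: logderivX.
- by rewrite -[1 *+ _]/E; lra.
have [|||||e2 e2_gt0 P2] := @logderiv_lt R (X ^+ x) (Y ^+ y * Q ^+ d)
   ((4 * J) *+ x) ((4 * Jb) *+ y + 1 *+ d).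
- by rewrite horner_exp exprn_gt0.
- by rewrite hornerM !horner_exp mulr_gt0 ?exprn_gt0.
- exact: logderivX.
- by apply: logderivM; apply: logderivX.
- have n_neq0 : n%:R != 0 :> R by rewrite pnatr_eq0.
  have mE : m.-1%:R = m%:R - 1 :> R by rewrite -subn1 natrB.
  have nE : n%:R = m%:R + 1 :> R by rewrite /n -natr1.
  have dE : d%:R = m%:R * (x%:R * n%:R - y%:R * m.-1%:R) :> R.
    by rewrite /d natrB ?exponent_le // !natrM; ring.
  have xy' : 0 < x%:R * n%:R - y%:R * m.-1%:R :> R.
    by rewrite subr_gt0 -!natrM ltr_nat.
  have n_gt0 : 0 < n%:R :> R by rewrite ltr0n.
  rewrite -(mulr_natr (4 * J) x) -(mulr_natr (4 * Jb) y) -[1 *+ d]/(d%:R) dE -subr_gt0.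
  have JE : 0 < 4 * J - n%:R * m%:R by move: J_gt; rewrite /E natrM; lra.
  have H : 0 < (4 * J - n%:R * m%:R) * (x%:R * n%:R - y%:R * m.-1%:R) by apply: mulr_gt0.
  have H2 : 0 <= ((1 - 2 / n%:R) * J - Jb) * y%:R by rewrite mulr_ge0 ?subr_ge0.
  rewrite -(pmulr_rgt0 _ n_gt0).
  (* The gap in growth rates, times n, splits into the excess 4 J - E with positive weight d / m and
     the slack in [fisher_crit_le]. *)
  have -> : n%:R * (4 * J * x%:R - (4 * Jb * y%:R + m%:R * (x%:R * n%:R - y%:R * m.-1%:R))) =
     (4 * J - n%:R * m%:R) * (x%:R * n%:R - y%:R * m.-1%:R)
      + 4 * n%:R * (((1 - 2 / n%:R) * J - Jb) * y%:R).
    by rewrite mE; move: n_neq0; rewrite nE => ?; field.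
  by apply: ltr_wpDr => //; rewrite mulr_ge0 // mulr_ge0 // ltW.
pose e := Num.min e1 e2 / 2.
have e12 : 0 < Num.min e1 e2 by rewrite lt_min e1_gt0.
have e_gt0 : 0 < e by rewrite divr_gt0.
have elt : e < Num.min e1 e2 by rewrite /e; lra.
move: elt; rewrite lt_min => /andP[ee1 ee2].
have {P1} := P1 e; rewrite e_gt0 ee1 => /(_ isT).
have {P2} := P2 e; rewrite e_gt0 ee2 => /(_ isT).
rewrite !hornerM !horner_exp Q0 X0 Y0 (Xe e) (Ye e); set q := Q.[e].
have q_gt0 : 0 < q.
  rewrite /q Qe (eq_bigr (fun i => a i ^+ 2 + (2 * e) * (a i * v i) + e ^+ 2 * v i ^+ 2)).
    rewrite !big_split /= -!mulr_sumr a_E av -/J.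
    have J_ge0 : 0 <= J by rewrite sumr_ge0 // => i _; apply: sqr_ge0.
    have := mulr_gt0 e_gt0 E_gt0; have := mulr_ge0 (sqr_ge0 e) J_ge0; lra.
  by move=> i _; ring.
have {}X0 := X0; set a1 := (fun i => a i + e * v i) => P2 P1.
have Xa_gt0 : 0 < disc2 a by rewrite -X0.
(* The first comparison makes [disc2 a1] positive, so the moved roots stay distinct. *)
have a1_inj : injective a1.
  apply/disc2_gt0; rewrite -(pmulr_lgt0 _ (exprn_gt0 (n * m) E_gt0)).
  by apply: lt_trans P1; rewrite mulr_gt0 ?exprn_gt0.
have sum1 : \sum_i a1 i = 0.
  by rewrite big_split /= -mulr_sumr a_0 score_sum_eq0 mulr0 addr0.
(* Scaling by the square root of E / q restores the sum of squares. *)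
pose s := E / q; have s_gt0 : 0 < s by rewrite divr_gt0.
pose t := Num.sqrt s; have t2 : t ^+ 2 = s by rewrite sqr_sqrtr // ltW.
have t0 : t != 0 by rewrite gt_eqF // sqrtr_gt0.
have sq : s * q = E by rewrite /s divfK // gt_eqF.
exists (fun i => t * a1 i + 0); last split.
- split; first exact: affine_inj.
    by rewrite big_split /= sumr_const mul0rn addr0 -mulr_sumr sum1 mulr0.
  rewrite (eq_bigr (fun i => s * a1 i ^+ 2)) => [|i _]; last by rewrite addr0 exprMn t2.
  by rewrite -mulr_sumr -Qe.
- rewrite disc2_affine t2 -(ltr_pM2l (exprn_gt0 (n * m) q_gt0)) mulrA -exprMn mulrC.
  by rewrite [q * s]mulrC sq [X in _ < X]mulrC mulrC.
rewrite disc2_affine cdisc_affine // t2; apply: rescaled_ratio_lt s_gt0 q_gt0 _ _.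
  exact: exponentE.
by rewrite sq.
Qed.

End Ascent.

(** * Hermite polynomials *)

Section Hermite.
Variable R : realType.

Lemma coef_hermite n i : (hermite R n)`_i =
  \sum_(k < n.+1) (- 2^-1) ^+ k / k`!%:R * ((2 * k + i == n)%N%:R *+ (2 * k + i) ^_ (2 * k)).
Proof.
rewrite /hermite coef_sum; apply: eq_bigr => k _.
by rewrite coefZ coef_derivn coefXn.
Qed.

Lemma coef_hermite_even n i k : (i + 2 * k = n)%N ->
  (hermite R n)`_i = (- 2^-1) ^+ k / k`!%:R * (n ^_ (2 * k))%:R.
Proof.
move=> ikn; have kn : (k < n.+1)%N by lia.
rewrite coef_hermite (bigD1 (Ordinal kn)) //= big1 ?addr0 => [|l lk].
  by rewrite addnC ikn eqxx.
case: eqP => [E|_]; last by rewrite mul0rn mulr0.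
by case/eqP: lk; apply/val_inj => /=; lia.
Qed.

Lemma coef_hermite_odd n i k : (i + (2 * k).+1 = n)%N -> (hermite R n)`_i = 0.
Proof.
move=> ikn; rewrite coef_hermite big1 // => l _.
by case: eqP => [E|_]; [lia | rewrite mul0rn mulr0].
Qed.

Lemma coef_hermite_gt n i : (n < i)%N -> (hermite R n)`_i = 0.
Proof.
move=> ni; rewrite coef_hermite big1 // => l _.
by case: eqP => [E|_]; [lia | rewrite mul0rn mulr0].
Qed.

(** The equation is a two-step recurrence on coefficients, solved downwards: from the leading
    coefficient 1 for the parity of n, and from the zero coefficient of degree n + 1 for the other
    parity. *)
Lemma hermite_unique n (p : {poly R}) : p \is monic -> size p = n.+1 ->
  p^`()^`() - 'X * p^`() + n%:R *: p = 0 -> p = hermite R n.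
Proof.
move=> p_monic sp ode.
have rec i : (n%:R - i%:R) * p`_i = - (i.+2%:R * i.+1%:R) * p`_i.+2.
  have := congr1 (fun q : {poly R} => q`_i) ode.
  rewrite !coefD coefN coefZ coefXM !coef_deriv coef0.
  case: i => [|i] /= E; first by lra.
  move: E; rewrite -(mulr_natr (_ *+ _) i.+2) -(mulr_natr (p`_i.+3) i.+3).
  by rewrite -(mulr_natr (p`_i.+1) i.+1); lra.
have pn : p`_n = 1 by move: p_monic; rewrite monicE lead_coefE sp => /eqP.
have p_gt i : (n < i)%N -> p`_i = 0 by move=> ni; rewrite nth_default // sp.
have even k : forall i, (i + 2 * k = n)%N -> p`_i = (hermite R n)`_i.
  elim: k => [|k IHk] i ikn.
    rewrite (coef_hermite_even ikn) muln0 ffactn0 expr0 fact0 divr1 mulr1.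
    by move: ikn; rewrite muln0 addn0 => ->.
  have ikn' : (i.+2 + 2 * k = n)%N by lia.
  have := rec i; rewrite (IHk _ ikn') (coef_hermite_even ikn) (coef_hermite_even ikn').
  have -> : (2 * k.+1 = (2 * k).+2)%N by lia.
  rewrite !ffactnSr factS !natrM.
  have -> : (n - (2 * k).+1 = i.+1)%N by lia.
  have -> : (n - 2 * k = i.+2)%N by lia.
  have -> : n%:R - i%:R = 2 * k.+1%:R :> R by rewrite -natrB -?natrM; [congr _%:R|]; lia.
  have k0 : k.+1%:R != 0 :> R by rewrite pnatr_eq0.
  move=> E; apply: (mulfI k0); apply: (@mulfI _ 2); first by rewrite pnatr_eq0.
  rewrite mulrA E exprS.
  have f0 : k`!%:R != 0 :> R by rewrite pnatr_eq0 -lt0n fact_gt0.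
  by field; rewrite f0 nat1r.
have odd k : forall i, (i + (2 * k).+1 = n)%N -> p`_i = 0.
  elim: k => [|k IHk] i ikn.
    have := rec i; rewrite (p_gt i.+2) ?mulr0; last by lia.
    by rewrite -natrB; [rewrite (_ : (n - i = 1)%N) ?mul1r //|]; lia.
  have := rec i; rewrite (IHk i.+2) ?mulr0; last by lia.
  move/eqP; rewrite mulf_eq0 -natrB; last by lia.
  by rewrite pnatr_eq0 => /orP[|/eqP //]; lia.
apply/polyP => i; have [ni|iln] := ltnP n i; first by rewrite p_gt // coef_hermite_gt.
have := odd_double_half (n - i); case: (boolP (ssrnat.odd _)) => _ E.
  by rewrite (odd (n - i)./2) ?(@coef_hermite_odd _ _ (n - i)./2) //; lia.
by rewrite (even (n - i)./2) //; lia.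
Qed.

(** Argument of Stieltjes: the coefficients of degree n cancel, so the left side has degree below n,
    and it vanishes at the n roots because p''(h_i) = 2 J_i p'(h_i) = h_i p'(h_i). *)
Lemma rootpoly_score_hermite n (h : 'I_n -> R) : injective h ->
  (forall i, score h i = h i / 2) ->
  (rootpoly h)^`()^`() - 'X * (rootpoly h)^`() + n%:R *: rootpoly h = 0.
Proof.
move=> h_inj hs; apply: (rootpoly_interpolation h_inj).
  apply/leq_sizeP => j nj.
  rewrite !coefD coefN coefZ coefXM !coef_deriv.
  have P0 k : (n < k)%N -> (rootpoly h)`_k = 0.
    by move=> nk; rewrite nth_default // size_rootpoly.
  rewrite (P0 j.+2) ?mul0rn; last by lia.
  case: j nj => [|j] nj /=.
    have n0 : n%:R = 0 :> R by apply/eqP; rewrite pnatr_eq0; lia.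
    by rewrite n0 mul0r subr0 addr0.
  rewrite sub0r -(mulr_natr _ j.+1) mulrC; apply/eqP; rewrite addrC subr_eq0; apply/eqP.
  have [nj'|nj'] := eqVneq n j.+1; first by congr (_%:R * _).
  by rewrite P0 ?mulr0 //; lia.
move=> i; rewrite !hornerE deriv2_rootpoly_root // hs rootpoly_root.
by field.
Qed.

(** A maximizer violating J_i = h_i / 2 would be improved by [ascent], which also increases [disc2]
    and so respects its lower bound. *)
Lemma max_hermite m x y (a : 'I_m.+1 -> R) : (0 < m)%N ->
  (y * m.-1 < x * m.+1)%N -> standardized a ->
  exists h : 'I_m.+1 -> R, [/\ standardized h, rootpoly h = hermite R m.+1,
    forall i, score h i = h i / 2 &
    disc2 a ^+ x * cdisc h ^+ y <= disc2 h ^+ x * cdisc a ^+ y].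
Proof.
move=> m_gt0 xy Sa; have [h [Sh ah] hmax] := disc_ratio_max x y Sa.
have hs i : score h i = h i / 2.
  apply/eqP; apply: contraT => hi.
  have [h' Sh' [hh' lt]] := ascent m_gt0 xy Sh (ex_intro _ i hi).
  by have := hmax h' Sh' (le_trans ah (ltW hh')); rewrite leNgt lt.
have h_inj : injective h by case: Sh.
exists h; split; [exact: Sh| |exact: hs|exact: (hmax a Sa (lexx _))].
apply: hermite_unique; [exact: monic_rootpoly|exact: size_rootpoly|].
exact: rootpoly_score_hermite.
Qed.

(** Differentiating the Hermite equation lowers its parameter by one. *)
Lemma hermite_crit m (h : 'I_m.+1 -> R) (b : 'I_m -> R) : injective h ->
  (forall i, score h i = h i / 2) ->
  (rootpoly h)^`() = m.+1%:R *: rootpoly b -> rootpoly b = hermite R m.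
Proof.
move=> h_inj hs hb; apply: hermite_unique; [exact: monic_rootpoly|exact: size_rootpoly|].
have /(congr1 (fun q => q^`())) := rootpoly_score_hermite h_inj hs.
rewrite derivD derivB derivM derivX mul1r derivZ deriv0 hb !derivZ => E.
apply: (@scalerI _ _ m.+1%:R); first by rewrite pnatr_eq0.
rewrite scaler0 -{}E !scalerDr !scalerN !scalerA -scalerAr -natr1 scalerDl scale1r.
by rewrite -!mul_polyC !(polyCD, polyCM); ring.
Qed.

End Hermite.

(** * Logarithmic inequalities and positivity of the gap *)

Section LogForm.
Variable R : realType.

(** As the product of p'^2 over the roots, [disc2] is visibly independent of their order. *)
Lemma disc2_rootpoly n (f g : 'I_n -> R) : rootpoly f = rootpoly g -> disc2 f = disc2 g.
Proof.
have disc2E (k : 'I_n -> R) : disc2 k =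
    \prod_(x <- [seq k i | i <- index_enum 'I_n]) (rootpoly k)^`().[x] ^+ 2.
  rewrite big_map; apply: eq_bigr => i _.
  by rewrite deriv_rootpoly_root -prodrXl.
move=> fg; rewrite !disc2E fg; apply: perm_big; apply: prod_XsubC_eq.
by rewrite !big_map.
Qed.

Definition sumsq_dev n (a : 'I_n -> R) : R :=
  \sum_i a i ^+ 2 - (\sum_i a i) ^+ 2 / n%:R.

Lemma sumsq_devE n (a : 'I_n -> R) : (0 < n)%N ->
  sumsq_dev a = \sum_i (a i - (\sum_j a j) / n%:R) ^+ 2.
Proof.
move=> n_gt0; set s := \sum_j a j; have n0 : n%:R != 0 :> R by rewrite pnatr_eq0 -lt0n.
rewrite (eq_bigr (fun i => a i ^+ 2 - (2 * s / n%:R) * a i + (s / n%:R) ^+ 2)).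
  rewrite big_split sumrB /= -mulr_sumr sumr_const card_ord -/s /sumsq_dev -/s.
  by rewrite -[_ *+ n]mulr_natr; field.
by move=> i _; field.
Qed.

Lemma sumsq_dev_gt0 n (a : 'I_n -> R) : (1 < n)%N -> injective a -> 0 < sumsq_dev a.
Proof.
case: n a => [//|m] a; rewrite ltnS => m_gt0 a_inj.
rewrite sumsq_devE // lt_def sumr_ge0 ?andbT => [|i _]; last exact: sqr_ge0.
apply/negP; rewrite psumr_eq0 => [/allP H|i _]; last exact: sqr_ge0.
have E i : a i = (\sum_j a j) / m.+1%:R.
  by have := H i; rewrite mem_index_enum sqrf_eq0 subr_eq0 => /(_ isT) /eqP.
have : (ord0 : 'I_m.+1) = ord_max by apply: a_inj; rewrite !E.
by move/(congr1 val) => /= m0; rewrite -m0 in m_gt0.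
Qed.

Lemma standardize m (a : 'I_m.+1 -> R) : (0 < m)%N -> injective a ->
  exists t u, [/\ t != 0, t ^+ 2 = (m.+1 * m)%:R / sumsq_dev a &
    standardized (fun i => t * a i + u)].
Proof.
move=> m_gt0 a_inj; have V_gt0 : 0 < sumsq_dev a by apply: sumsq_dev_gt0.
set V := sumsq_dev a in V_gt0 *; pose s := \sum_i a i.
have s_gt0 : 0 < (m.+1 * m)%:R / V by rewrite divr_gt0 // ltr0n muln_gt0.
pose t := Num.sqrt ((m.+1 * m)%:R / V).
have t0 : t != 0 by rewrite gt_eqF // sqrtr_gt0.
have t2 : t ^+ 2 = (m.+1 * m)%:R / V by rewrite sqr_sqrtr // ltW.
have n0 : m.+1%:R != 0 :> R by rewrite pnatr_eq0.
exists t, (- (t * (s / m.+1%:R))); split => //; split.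
- exact: affine_inj.
- rewrite big_split /= -mulr_sumr sumr_const card_ord -/s -(mulr_natr (- _)).
  by rewrite mulNr -mulrA divfK // subrr.
rewrite (eq_bigr (fun i => t ^+ 2 * (a i - s / m.+1%:R) ^+ 2)) => [|i _]; last by ring.
by rewrite -mulr_sumr -sumsq_devE // t2 -/V divfK // gt_eqF.
Qed.

(** That H_n has simple real roots comes from the maximum problem with x = 1 and y = 0, started at
    the standardized integers 0, ..., m. *)
Lemma hermite_roots m : (0 < m)%N -> exists h : 'I_m.+1 -> R,
  [/\ standardized h, rootpoly h = hermite R m.+1 & forall i, score h i = h i / 2].
Proof.
move=> m_gt0; have nat_inj : injective (fun i : 'I_m.+1 => i%:R : R).
  by move=> i j /eqP; rewrite eqr_nat => /eqP /val_inj.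
have [t [u [_ _ S]]] := standardize m_gt0 nat_inj.
have [//|h [Sh hP hs _]] := @max_hermite _ m 1 0 _ m_gt0 _ S.
by exists h.
Qed.

Lemma ln_disc2_affine n (f : 'I_n -> R) t u : t != 0 -> injective f ->
  ln (disc2 (fun i => t * f i + u)) = (n * n.-1)%:R * ln (t ^+ 2) + ln (disc2 f).
Proof.
move=> t0 f_inj; have t2 : 0 < t ^+ 2 by rewrite exprn_even_gt0.
have df : 0 < disc2 f by apply/disc2_gt0.
have dt : 0 < (t ^+ 2) ^+ (n * n.-1) by apply: exprn_gt0.
by rewrite disc2_affine lnM ?posrE // lnXn // mulr_natl.
Qed.

(** Archimedean form of letting the weight K tend to infinity. *)
Lemma le0_of_natmul_bounded (u w : R) : (forall k : nat, k%:R * u <= w) -> u <= 0.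
Proof.
move=> uw; rewrite leNgt; apply/negP => u_gt0.
have w_ge0 : 0 <= w by have := uw 0%N; rewrite mul0r.
have := uw (Num.bound (w / u)).
have := archi_boundP (divr_ge0 w_ge0 (ltW u_gt0)); rewrite ltr_pdivrMr // => lt.
by rewrite leNgt lt.
Qed.

Lemma ln_ratio_le (p q r s : R) (x y : nat) : 0 < p -> 0 < q -> 0 < r -> 0 < s ->
  p ^+ x * s ^+ y <= r ^+ x * q ^+ y ->
  x%:R * ln p + y%:R * ln s <= x%:R * ln r + y%:R * ln q.
Proof.
move=> p0 q0 r0 s0; have pos (z : R) k : 0 < z -> 0 < z ^+ k by apply: exprn_gt0.
rewrite -ler_ln ?posrE; try by apply: mulr_gt0; apply: pos.
by rewrite !lnM ?posrE ?pos // !lnXn // !mulr_natl.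
Qed.

(* The exponents are chosen so that the ratio
   [disc2 a ^+ (m - 1) / disc2 b ^+ (m + 1)] is invariant under affine maps. *)
Lemma hermite_ratio_max m (a h : 'I_m.+1 -> R) (b g : 'I_m -> R) : (0 < m)%N ->
  injective a -> (rootpoly a)^`() = m.+1%:R *: rootpoly b ->
  rootpoly h = hermite R m.+1 -> rootpoly g = hermite R m ->
  m.-1%:R * ln (disc2 a) - m.+1%:R * ln (disc2 b) <=
  m.-1%:R * ln (disc2 h) - m.+1%:R * ln (disc2 g).
Proof.
move=> m_gt0 a_inj ab hP gP.
have [t [u [t0 _ S]]] := standardize m_gt0 a_inj.
pose a1 i := t * a i + u; pose b1 j := t * b j + u.
have ab1 : (rootpoly a1)^`() = m.+1%:R *: rootpoly b1 by apply: crit_affine.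
have a1_inj : injective a1 by apply: affine_inj.
have b_inj := crit_inj a_inj ab.
suff : m.-1%:R * ln (disc2 a1) - m.+1%:R * ln (disc2 b1) <=
    m.-1%:R * ln (disc2 h) - m.+1%:R * ln (disc2 g).
  rewrite !ln_disc2_affine //; apply: le_trans; rewrite le_eqVlt; apply/orP; left.
  by apply/eqP; rewrite !natrM /=; ring.
rewrite -subr_le0; set w := ln (disc2 h) - ln (disc2 a1).
apply: (@le0_of_natmul_bounded _ w) => k.
(* The exponents are k times the scale-invariant ones, plus one extra factor [disc2], which makes
   this strict and contributes only the constant w. *)
have xy : ((m.+1 * k) * m.-1 < (m.-1 * k).+1 * m.+1)%N by nia.
have [h' [[h'_inj _ _] h'P h's]] := max_hermite m_gt0 xy S.
have [g' hg'] := crit_exists h'_inj.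
have -> : disc2 g = disc2 g'.
  by apply: disc2_rootpoly; rewrite gP (hermite_crit h'_inj h's hg').
rewrite /w (_ : disc2 h = disc2 h'); last by apply: disc2_rootpoly; rewrite hP h'P.
rewrite (cdiscE h'_inj hg') -/a1 (cdiscE a1_inj ab1).
have da : 0 < disc2 a1 by apply/disc2_gt0.
have dh : 0 < disc2 h' by apply/disc2_gt0.
have db : 0 < disc2 b1 by apply/disc2_gt0; apply: crit_inj a1_inj ab1.
have dg : 0 < disc2 g' by apply/disc2_gt0; apply: crit_inj h'_inj hg'.
move=> H; have {H} := ln_ratio_le da db dh dg H.
by rewrite -!natr1 !natrM; lra.
Qed.

Lemma prod_lift (A : comNzRingType) m (i : 'I_m.+1) (P : pred 'I_m.+1) (F : 'I_m.+1 -> A) :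
  \prod_(j < m | P (lift i j)) F (lift i j) = \prod_(k | (k != i) && P k) F k.
Proof.
rewrite big_mkcond [RHS]big_mkcond (bigD1_ord i) //= eqxx mul1r.
by apply: eq_bigr => j _; rewrite eq_sym neq_lift.
Qed.

(** Each ordered pair survives the deletion of any of the m - 1 other indices. *)
Lemma prod_disc2_lift m (h : 'I_m.+1 -> R) :
  \prod_i disc2 (fun j => h (lift i j)) = disc2 h ^+ m.-1.
Proof.
pose c k l := (h k - h l) ^+ 2.
transitivity (\prod_i \prod_(k | k != i) \prod_(l | (l != i) && (l != k)) c k l).
  apply: eq_bigr => i _.
  rewrite -[RHS](eq_bigl _ _ (fun k => andbT (k != i))) -(prod_lift i predT) /=.
  apply: eq_bigr => k _; rewrite -prod_lift.
  by apply: eq_bigl => l; rewrite (inj_eq lift_inj).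
rewrite (exchange_big_dep predT) //= /disc2 -prodrXl; apply: eq_bigr => k _.
rewrite -prodrXl (exchange_big_dep (fun l => l != k)) /=; last by move=> i l _ /andP[].
apply: eq_bigr => l lk; rewrite prodr_const; congr (_ ^+ _).
have := cardsC [set k; l]; rewrite cards2 eq_sym lk card_ord => E.
have -> : m.-1 = #|~: [set k; l]| by lia.
apply: eq_card => i; rewrite !inE.
by rewrite unfold_in andbT negb_or ![i == _]eq_sym.
Qed.

(** Without h_i the sum is - h_i and the sum of squares loses h_i^2. The mean over i is m^2 - 1, and
    its deficit from m^2 makes [hermite_gap] strict. *)
Lemma sum_sumsq_dev_lift m (h : 'I_m.+1 -> R) : (0 < m)%N -> standardized h ->
  \sum_i sumsq_dev (fun j => h (lift i j)) = (m.+1 ^ 2 * m.-1)%:R.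
Proof.
move=> m_gt0 [_ h0 hE].
have sum_lift (F : 'I_m.+1 -> R) (i : 'I_m.+1) : \sum_(j < m) F (lift i j) = \sum_k F k - F i.
  by rewrite [in RHS](bigD1_ord i) //= addrAC subrr add0r.
rewrite (eq_bigr (fun i => (m.+1 * m)%:R - (1 + m%:R^-1) * h i ^+ 2)) => [|i _].
  rewrite sumrB sumr_const card_ord -mulr_sumr hE -mulr_natr.
  have m0 : m%:R != 0 :> R by rewrite pnatr_eq0 -lt0n.
  by rewrite !natrM -subn1 natrB // -natr1; field.
rewrite /sumsq_dev !(sum_lift (fun k => h k ^+ 2)) (sum_lift h) h0 hE sub0r sqrrN.
by ring.
Qed.

Lemma hermite_disc2_max m (a g : 'I_m -> R) : (1 < m)%N -> injective a ->
  rootpoly g = hermite R m ->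
  ln (disc2 a) <= ln (disc2 g) + (m * m.-1)%:R * ln (sumsq_dev a / (m * m.-1)%:R).
Proof.
case: m a g => [//|m] a g; rewrite ltnS => m_gt0 a_inj gP.
have [t [u [t0 t2 S]]] := standardize m_gt0 a_inj.
have [//|h [[h_inj _ _] hP _]] := @max_hermite _ m 1 0 _ m_gt0 _ S.
rewrite !expr0 !expr1 !mulr1 -(disc2_rootpoly (etrans gP (esym hP))) => le.
have a1_inj : injective (fun i => t * a i + u) by apply: affine_inj.
have da : 0 < disc2 (fun i => t * a i + u) by apply/disc2_gt0.
have dg : 0 < disc2 g by apply: lt_le_trans le.
rewrite -ler_ln ?posrE // ln_disc2_affine // t2 /= in le.
have V_gt0 : 0 < sumsq_dev a by apply: sumsq_dev_gt0.
have E_gt0 : 0 < (m.+1 * m)%:R :> R by rewrite ltr0n muln_gt0.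
have : ln (sumsq_dev a / (m.+1 * m)%:R) = - ln ((m.+1 * m)%:R / sumsq_dev a).
  by rewrite -lnV ?posrE ?divr_gt0 // invf_div.
by move=> ->; rewrite mulrN; lra.
Qed.

Lemma sum_ln (I : Type) (r : seq I) (P : pred I) (f : I -> R) :
  (forall i, P i -> 0 < f i) ->
  \sum_(i <- r | P i) ln (f i) = ln (\prod_(i <- r | P i) f i).
Proof.
move=> f0; suff [] : \sum_(i <- r | P i) ln (f i) = ln (\prod_(i <- r | P i) f i) /\
  0 < \prod_(i <- r | P i) f i by [].
apply: (big_rec2 (fun s p => s = ln p /\ 0 < p)) => [|i s p Pi [-> p0]]; first by rewrite ln1.
by have f0i := f0 i Pi; rewrite lnM ?posrE // mulr_gt0.
Qed.

Lemma hermite_gap m (h : 'I_m.+1 -> R) (g : 'I_m -> R) : (1 < m)%N ->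
  rootpoly h = hermite R m.+1 -> rootpoly g = hermite R m ->
  m.-1%:R * ln (disc2 h) <
  m.+1%:R * ln (disc2 g) + (m.+1 * (m * m.-1))%:R * ln (m%:R / m.-1%:R).
Proof.
move=> m_gt1 hP gP; have m_gt0 := ltnW m_gt1.
have [h' [Sh h'P _]] := hermite_roots m_gt0.
rewrite (disc2_rootpoly (etrans hP (esym h'P))).
have h'_inj : injective h' by case: Sh.
pose x i j := h' (lift i j).
have x_inj i : injective (x i) by move=> j k /h'_inj /lift_inj.
have dh : 0 < disc2 h' by apply/disc2_gt0.
have m1 : 0 < m.-1%:R :> R by rewrite ltr0n; lia.
have m0 : 0 < m%:R :> R by rewrite ltr0n.
pose E : R := (m * m.-1)%:R; have E_gt0 : 0 < E by rewrite ltr0n muln_gt0 m_gt0; lia.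
pose kap : R := m%:R / m.-1%:R; have kap_gt0 : 0 < kap by rewrite divr_gt0.
have Ek : E * kap = m%:R ^+ 2.
  by rewrite /E /kap natrM; field; rewrite gt_eqF.
have V_gt0 i : 0 < sumsq_dev (x i) by apply: sumsq_dev_gt0.
have -> : m.-1%:R * ln (disc2 h') = \sum_i ln (disc2 (x i)).
  rewrite sum_ln => [|i _]; last by apply/disc2_gt0; apply: x_inj.
  by rewrite prod_disc2_lift lnXn // mulr_natl.
(* Here ln t <= t - 1 is used at t = V / m^2, where V = [sumsq_dev (x i)]; the reference m^2 is the
   V for which V / E = kap. *)
have bound i : ln (disc2 (x i)) <=
    ln (disc2 g) + E * (ln kap + (sumsq_dev (x i) / m%:R ^+ 2 - 1)).
  apply: le_trans (hermite_disc2_max m_gt1 (@x_inj i) gP) _.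
  rewrite lerD2l ler_pM2l //.
  have -> : sumsq_dev (x i) / E = kap * (sumsq_dev (x i) / m%:R ^+ 2).
    by rewrite -Ek; field; rewrite !gt_eqF.
  rewrite lnM ?posrE ?divr_gt0 ?exprn_gt0 // lerD2l.
  have := @le_ln1Dx R (sumsq_dev (x i) / m%:R ^+ 2 - 1); rewrite (addrC 1) subrK; apply.
  by rewrite -subr_gt0 opprK subrK divr_gt0 ?exprn_gt0.
apply: le_lt_trans (ler_sum _ (fun i _ => bound i)) _.
rewrite big_split /= sumr_const card_ord -mulr_sumr big_split /= sumr_const card_ord.
rewrite big_split /= sumr_const card_ord -mulr_suml sum_sumsq_dev_lift //.
rewrite -(mulr_natl (ln (disc2 g)) m.+1) -(mulr_natl (ln kap) m.+1) -(mulr_natl (-1) m.+1).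
rewrite ltrD2l natrM -/E -/kap [ltRHS](_ : _ = E * (m.+1%:R * ln kap)); last by ring.
rewrite ltr_pM2l //.
rewrite gtrDl natrM.
have -> : m.-1%:R = m%:R - 1 :> R by rewrite -subn1 natrB.
rewrite (_ : _ + _ = - (m.+1%:R / m%:R ^+ 2)); last first.
  by rewrite -natr1; field; rewrite gt_eqF.
by rewrite oppr_lt0 divr_gt0 ?exprn_gt0 // ltr0n.
Qed.

End LogForm.

(** * Entropy of real-rooted polynomials *)

Section Entropy.
Variable R : realType.

Definition rootfun n (q : {poly R}) (i : 'I_n) : R := (root_seq q)`_i.

Lemma ln_disc2E n (f : 'I_n -> R) : injective f ->
  ln (disc2 f) = 4 * \sum_(i < n) \sum_(j < n | (i < j)%N) ln `|f i - f j|.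
Proof.
move=> f_inj; have fN i j : j != i -> 0 < `|f i - f j|.
  by move=> ji; rewrite normr_gt0 subr_eq0; apply: contra_neq ji => /f_inj.
have f2 i j : j != i -> 0 < (f i - f j) ^+ 2.
  by move=> ji; rewrite -real_normK ?num_real // exprn_gt0 ?fN.
rewrite -sum_ln => [|i _]; last by apply: prodr_gt0 => j; apply: f2.
rewrite (eq_bigr (fun i => 2 * \sum_(j | j != i) ln `|f i - f j|)) => [|i _].
  rewrite -mulr_sumr big_offdiag_sym => [|i j]; last by rewrite distrC.
  by rewrite /=; ring.
rewrite -sum_ln => [|j]; last exact: f2.
rewrite mulr_sumr; apply: eq_bigr => j ji.
by rewrite -real_normK ?num_real // lnXn ?fN // mulr_natl.
Qed.

Lemma chi_injective n (q : {poly R}) : injective (@rootfun n q) ->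
  chi n q = (ln (disc2 (@rootfun n q)) / (2 * (n%:R * (n%:R - 1))))%:E.
Proof.
move=> f_inj; rewrite /chi ln_disc2E //.
rewrite (eq_bigr (fun i : 'I_n => (\sum_(j < n | (i < j)%N) ln `|rootfun q i - rootfun q j|)%:E)).
  rewrite sumEFin -EFinM; congr (_%:E).
  set k := n%:R * _; rewrite (invfM 2 k); set k1 := k^-1.
  by field.
move=> i _; rewrite -sumEFin; apply: eq_bigr => j ij.
by rewrite lne_EFin // normr_gt0 subr_eq0; apply: contraTneq ij => /f_inj ->; rewrite ltnn.
Qed.

Lemma chi_not_injective n (q : {poly R}) : (1 < n)%N -> ~ injective (@rootfun n q) ->
  chi n q = -oo%E.
Proof.
move=> n_gt1 f_ninj.
have [i [j [ij fij]]] : exists i j : 'I_n, (i < j)%N /\ rootfun q i = rootfun q j.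
  apply: contrapT => H; apply: f_ninj => i j fij; apply/val_inj.
  by case: (ltngtP i j) => // ij; case: H; [exists i, j | exists j, i].
rewrite /chi; have -> : (\sum_(i < n) \sum_(j < n | (i < j)%N)
      lne `|(root_seq q)`_i - (root_seq q)`_j|%:E = -oo)%E.
  (* One summand -oo makes the whole extended sum -oo. *)
  apply/esum_eqNyP; exists i; split=> //; apply/esum_eqNyP; exists j; split=> //.
  by move: fij; rewrite /rootfun => ->; rewrite subrr normr0 le0_lneNy.
rewrite gt0_muleNy // lte_fin divr_gt0 // mulr_gt0 ?subr_gt0 ?ltr1n // ltr0n.
exact: ltnW.
Qed.

Section Scaled.
Variables (m : nat) (l : R) (f : 'I_m -> R).
Hypothesis l_neq0 : l != 0.

(** [root_seq] is an arbitrary choice, pinned down up to order by unique factorization. The scalar l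
    accommodates p', which is not monic. *)
Lemma root_seq_perm : perm_eq (root_seq (l *: rootpoly f)) [seq f i | i <- index_enum 'I_m].
Proof.
have lc : lead_coef (l *: rootpoly f) = l.
  by rewrite lead_coefZ (monicP (monic_rootpoly f)) mulr1.
have : splits_as (l *: rootpoly f) (root_seq (l *: rootpoly f)).
  apply: (@xgetPex _ [::] [set s | splits_as (l *: rootpoly f) s]).
  by exists [seq f i | i <- index_enum 'I_m]; rewrite /= /splits_as lc big_map.
rewrite /splits_as lc => /(scalerI l_neq0) E.
by apply: prod_XsubC_eq; rewrite -E big_map.
Qed.

Lemma size_root_seq : size (root_seq (l *: rootpoly f)) = m.
Proof. by rewrite (perm_size root_seq_perm) size_map /index_enum -enumT size_enum_ord. Qed.

Lemma rootpoly_rootfun : rootpoly (@rootfun m (l *: rootpoly f)) = rootpoly f.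
Proof.
rewrite /rootfun -rootpoly_nth ?size_root_seq // (perm_big _ root_seq_perm) /=.
by rewrite big_map.
Qed.

Lemma poly_varianceE : poly_variance (l *: rootpoly f) = sumsq_dev f / m%:R.
Proof.
rewrite /poly_variance /poly_moment size_root_seq !(perm_big _ root_seq_perm) /= !big_map.
rewrite /sumsq_dev exprMn exprVn mulrBl expr2 invfM.
under [in X in _ - X]eq_bigr do rewrite expr1.
by rewrite expr2; ring.
Qed.

Lemma chi_rootpoly : injective f ->
  chi m (l *: rootpoly f) = (ln (disc2 f) / (2 * (m%:R * (m%:R - 1))))%:E.
Proof.
move=> f_inj; have E := disc2_rootpoly rootpoly_rootfun.
have inj : injective (@rootfun m (l *: rootpoly f)).
  by apply/disc2_gt0; rewrite E; apply/disc2_gt0.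
by rewrite (chi_injective inj) E.
Qed.

Lemma dilate_rootpoly c : c != 0 ->
  dilate c (l *: rootpoly f) = l *: rootpoly (fun i => c * f i + 0).
Proof.
move=> c0; rewrite /dilate size_scale // size_rootpoly /= rootpoly_affine //.
by rewrite comp_polyZ !scalerA mulrC polyC0 subr0.
Qed.

End Scaled.

Lemma chi_dilate m l (f : 'I_m -> R) c : l != 0 -> c != 0 -> (1 < m)%N -> injective f ->
  chi m (dilate c (l *: rootpoly f)) =
  (ln (c ^+ 2) / 2 + ln (disc2 f) / (2 * (m%:R * (m%:R - 1))))%:E.
Proof.
move=> l0 c0 m_gt1 f_inj; rewrite dilate_rootpoly // chi_rootpoly //; last exact: affine_inj.
rewrite ln_disc2_affine // natrM -subn1 natrB; last exact: ltnW.
congr (_%:E); have m0 : m%:R != 0 :> R by rewrite pnatr_eq0; lia.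
have m1 : m%:R - 1 != 0 :> R by rewrite subr_eq0 pnatr_eq1; lia.
by field; apply/andP.
Qed.

End Entropy.

Section Gap.
Variables (R : realType) (m : nat).
Hypothesis m_gt1 : (1 < m)%N.

Lemma chi_hermite_normalized k (h : 'I_k -> R) : (1 < k)%N -> injective h ->
  rootpoly h = hermite R k ->
  chi k (hermite_normalized R k) =
  (ln (disc2 h) / (2 * (k%:R * (k%:R - 1))) - ln (k%:R - 1) / 2)%:E.
Proof.
move=> k_gt1 h_inj hP; rewrite /hermite_normalized -hP -[rootpoly h]scale1r.
have k1 : 0 < k%:R - 1 :> R by rewrite subr_gt0 ltr1n.
rewrite chi_dilate ?oner_eq0 ?invr_eq0 ?gt_eqF ?sqrtr_gt0 //.
by rewrite exprVn sqr_sqrtr ?ltW // lnV ?posrE // mulNr addrC.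
Qed.

(** The term ln (m / (m - 1)) reflects the variances m and m - 1 of the two Hermite polynomials
    before normalization. *)
Lemma entropy_gapE (h : 'I_m.+1 -> R) (g : 'I_m -> R) :
  injective h -> injective g ->
  rootpoly h = hermite R m.+1 -> rootpoly g = hermite R m ->
  entropy_gap R m.+1 =
  ((ln (disc2 g) / (m%:R * (m%:R - 1)) - ln (disc2 h) / (m.+1%:R * m%:R)
    + ln (m%:R / (m%:R - 1))) / 2)%:E.
Proof.
move=> h_inj g_inj hP gP.
have m0 : 0 < m%:R :> R by rewrite ltr0n ltnW.
have m1 : 0 < m%:R - 1 :> R by rewrite subr_gt0 ltr1n.
rewrite /entropy_gap (chi_hermite_normalized _ h_inj hP) ?(chi_hermite_normalized _ g_inj gP) //.
  rewrite -EFinB; congr (_%:E).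
  rewrite ln_div ?posrE // -[m.+1%:R]natr1 addrK !invfM; set u := (_ - 1)^-1; set v := (_ + 1)^-1.
  by field; rewrite natr1 gt_eqF //= pnatr_eq0.
by rewrite ltnS ltnW.
Qed.

End Gap.

Unset Implicit Arguments.

(* The rescaled derivative is [dilate c p^`()]; when p has a root of
   multiplicity at least 3 both entropies are -oo, and the strict inequality
   is claimed only outside this case. *)
Theorem theorem1p6 (R : realType) (n : nat) (p : {poly R}) (c : R)
  (n_ge3 : (3 <= n)%N) (p_monic : p \is monic) (p_deg : size p = n.+1)
  (p_real_rooted : real_rooted p) (c_neq0 : c != 0)
  (c_var : poly_variance (dilate c p^`()) = poly_variance p) :
  [/\ (chi n p + entropy_gap R n <= chi n.-1 (dilate c p^`()))%E,
      (0 < entropy_gap R n)%E &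
      (chi n.-1 (dilate c p^`()) != -oo)%E ->
      (chi n p < chi n.-1 (dilate c p^`()))%E].
Proof.
case: n n_ge3 p_deg => [//|m]; rewrite ltnS => m_gt1 p_deg.
have m_gt0 := ltnW m_gt1.
have m0 : 0 < m%:R :> R by rewrite ltr0n.
have m1 : 0 < m%:R - 1 :> R by rewrite subr_gt0 ltr1n.
have n0 : 0 < m.+1%:R :> R by rewrite ltr0n.
have m1E : m.-1%:R = m%:R - 1 :> R by rewrite -subn1 natrB.
have [h [[h_inj _ _] hP hs]] := hermite_roots R m_gt0.
have [g hg] := crit_exists h_inj.
have gP := hermite_crit h_inj hs hg; have g_inj := crit_inj h_inj hg.
have gapE := entropy_gapE m_gt1 h_inj g_inj hP gP.
have gap_gt0 : (0 < entropy_gap R m.+1)%E.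
  have := hermite_gap m_gt1 hP gP; rewrite gapE lte_fin !natrM m1E.
  set H := ln (disc2 h); set G := ln (disc2 g); set K := ln (m%:R / _) => lt.
  rewrite (_ : _ / 2 = (m.+1%:R * G + m.+1%:R * (m%:R * (m%:R - 1)) * K - (m%:R - 1) * H)
      / (2 * m.+1%:R * m%:R * (m%:R - 1))); last by field; rewrite !gt_eqF.
  by rewrite divr_gt0 ?subr_gt0 // !mulr_gt0.
have [s ps] := p_real_rooted.
have p1 : lead_coef p = 1 by apply/eqP; rewrite -monicE.
have pE : p = \prod_(a <- s) ('X - a%:P) by rewrite ps p1 scale1r.
have ss : size s = m.+1 by move: p_deg; rewrite pE size_prod_XsubC => -[].
pose a (i : 'I_m.+1) := s`_i.
have pa : p = 1 *: rootpoly a by rewrite scale1r pE (rootpoly_nth ss).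
(* With a repeated root the left-hand sides are -oo, the gap being finite, and the strict inequality
   is its own hypothesis. *)
have [a_inj|a_ninj] := pselect (injective a); last first.
  have chip : chi m.+1 p = -oo%E.
    apply: chi_not_injective; first by rewrite ltnS ltnW.
    move/disc2_gt0; rewrite pa (disc2_rootpoly (rootpoly_rootfun _ _)) ?oner_eq0 //.
    by move/disc2_gt0.
  by rewrite chip; split; [rewrite gapE; exact: leNye | exact: gap_gt0 | rewrite ltNye].
have [b ab] := crit_exists a_inj; have b_inj := crit_inj a_inj ab.
have p'E : p^`() = m.+1%:R *: rootpoly b by rewrite pa scale1r.
have n0' : m.+1%:R != 0 :> R by rewrite gt_eqF.
(* The sum of squared deviations of b is (m - 1) / (m + 1) times that of a; dividing by m and m + 1
   points gives Var(p') = (m - 1) / m Var(p). *)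
have c2 : c ^+ 2 = m%:R / (m%:R - 1).
  have V0 : 0 < sumsq_dev a by apply: sumsq_dev_gt0.
  have Vb : sumsq_dev (fun j => c * b j + 0) = c ^+ 2 * ((m%:R - 1) / m.+1%:R * sumsq_dev a).
    rewrite /sumsq_dev (eq_bigr (fun j => c ^+ 2 * b j ^+ 2)) => [|j _]; last by ring.
    have -> : \sum_j (c * b j + 0) = c * \sum_j b j.
      by rewrite mulr_sumr; apply: eq_bigr => j _; rewrite addr0.
    rewrite -!mulr_sumr (crit_sum a_inj ab) (crit_sum_sqr a_inj ab).
    by rewrite -[m.+1%:R]natr1; field; rewrite natr1 !gt_eqF.
  move: c_var; rewrite p'E dilate_rootpoly // pa !poly_varianceE ?oner_eq0 // Vb.
  move=> E; apply: (@mulIf _ ((m%:R - 1) / m.+1%:R * sumsq_dev a / m%:R)).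
    by rewrite !mulf_neq0 ?invr_eq0 ?gt_eqF.
  by rewrite mulrA mulrA -[c ^+ 2 * _ * _]mulrA E; field; rewrite !gt_eqF.
have chip : chi m.+1 p = (ln (disc2 a) / (2 * (m.+1%:R * m%:R)))%:E.
  by rewrite pa chi_rootpoly ?oner_eq0 // -[m.+1%:R]natr1 addrK.
have chip' : chi m (dilate c p^`()) =
    (ln (m%:R / (m%:R - 1)) / 2 + ln (disc2 b) / (2 * (m%:R * (m%:R - 1))))%:E.
  by rewrite p'E chi_dilate // c2.
have le : (chi m.+1 p + entropy_gap R m.+1 <= chi m (dilate c p^`()))%E.
  have := hermite_ratio_max m_gt0 a_inj ab hP gP.
  rewrite chip chip' gapE -EFinD lee_fin m1E => H; rewrite -subr_ge0; rewrite -subr_ge0 in H.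
  (* The terms ln (m / (m - 1)) cancel, and this factor turns [hermite_ratio_max] into the entropy
     inequality. *)
  have D0 : 0 < (2 * m.+1%:R * m%:R * (m%:R - 1))^-1 :> R by rewrite invr_gt0 !mulr_gt0.
  have := mulr_ge0 (ltW D0) H; apply: etrans; congr (0 <= _); field.
  by rewrite !gt_eqF.
(* Strictness: a positive gap is added to the finite chi_n(p). *)
split=> // _; apply: lt_le_trans le.
by rewrite lteDl // chip.
Qed.
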